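(* Let $R\in\mathbb{R}$ and let $\mathcal{X}_{(-1,1)}$ denote the characteristic function of $(-1,1)$ and $\delta_{\pm1}$ the Dirac deltas at $x=\pm1$. Consider the linear operator $$L_1 g:=g_{xx}-g_{xx}(0)\,\mathcal{X}_{(-1,1)}-g_x(0)\,[\delta_{-1}-\delta_{1}]-R\,g_{xx}(0)\,[\delta_{-1}+\delta_{1}],$$ acting on functions $g:\mathbb{R}\to\mathbb{C}$ with $g(0)=0$. Call $\lambda\in\mathbb{C}$ an eigenvalue of $L_1$ if there is a nonzero, globally bounded function $g$ on $\mathbb{R}$ with $g(0)=0$ such that $L_1g=\lambda g$ (in the distributional sense). Let $a_0\approx 3.94$ be the root near $3.94$ of $\cos(a)-\sin(a)=e^{-a}$ and let $R_0=(1-e^{a_0}\cos(a_0))/a_0\approx 9.36$. Then every eigenvalue $\lambda$ of $L_1$ satisfies $\Re(\lambda)\le 0$ for all $-1\le R\le R_0$. Moreover, at $R=-1$ a real eigenvalue becomes positive (it equals $0$ at $R=-1$ and is positive for $R<-1$), and at $R=R_0$ a pair of simple, nonzero, complex conjugate eigenvalues crosses the imaginary axis from left to right as $R$ increases.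
   Context: This operator is the linearization around the equilibrium $w^1$ (where $w^1(x)=-x$ for $|x|\le1$, $w^1(x)=1$ for $x<-1$, $w^1(x)=-1$ for $x>1$) of the free-boundary price formation model $w_t=w_{xx}+p'(t)w_x-w_x(0,t)[\delta_{-1}-\delta_1]-Rp'(t)[\phi(w(-1,t))\delta_{-1}-\phi(w(1,t))\delta_1]$, $w(0,t)=0$, $p'(t)=-w_{xx}(0,t)/w_x(0,t)$, with $\phi$ odd and $\phi(\pm1)=\pm1$. The distributional equation $L_1g=\lambda g$ means: $g$ is continuous, $g''-g''(0)\mathcal{X}_{(-1,1)}=\lambda g$ away from $x=\pm1$, and $g'$ has jumps at $\pm1$ dictated by the delta terms. *)

(* Defs.v *)
From Stdlib Require Import Reals.
From Coquelicot Require Import Coquelicot Complex.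
Open Scope R_scope.

Definition chi11 (x : R) : R :=
  if Rlt_dec (-1) x then (if Rlt_dec x 1 then 1 else 0) else 0.

(* [solves Rp lam f h] : h : R -> C is continuous, globally bounded, h(0)=0,
   twice differentiable away from x = +-1 (h1 = h', h2 = h''), satisfies
   h'' - h''(0) X_(-1,1) - lam h = f away from +-1, and h' has one-sided
   limits at +-1 whose jumps are those dictated by the delta terms of
   (L_1 - lam) h = f, i.e.
     h'(-1+) - h'(-1-) =  h'(0) + Rp h''(0),
     h'( 1+) - h'( 1-) = -h'(0) + Rp h''(0).                               *)
Definition solves (Rp : R) (lam : C) (f : R -> C) (h : R -> C) : Prop :=
  exists h1 h2 : R -> C,
    (forall x, continuous h x) /\
    h 0 = RtoC 0 /\
    (exists M : R, forall x, Cmod (h x) <= M) /\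
    (forall x, x <> -1 -> x <> 1 -> is_derive h x (h1 x) /\ is_derive h1 x (h2 x)) /\
    (forall x, x <> -1 -> x <> 1 ->
       Cminus (Cminus (h2 x) (Cmult (RtoC (chi11 x)) (h2 0))) (Cmult lam (h x)) = f x) /\
    (exists dLm dRm dLp dRp : C,
       filterlim h1 (at_left (-1)) (locally dLm) /\
       filterlim h1 (at_right (-1)) (locally dRm) /\
       filterlim h1 (at_left 1) (locally dLp) /\
       filterlim h1 (at_right 1) (locally dRp) /\
       Cminus dRm dLm = Cplus (h1 0) (Cmult (RtoC Rp) (h2 0)) /\
       Cminus dRp dLp = Cplus (Copp (h1 0)) (Cmult (RtoC Rp) (h2 0))).

Definition eigenfunction (Rp : R) (lam : C) (g : R -> C) : Prop :=
  solves Rp lam (fun _ => RtoC 0) g /\ exists x, g x <> RtoC 0.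

Definition is_eigenvalue (Rp : R) (lam : C) : Prop :=
  exists g, eigenfunction Rp lam g.

(* algebraically simple: one-dimensional eigenspace and no Jordan chain
   (no bounded h with h(0)=0 and (L_1 - lam) h = g) *)
Definition simple_eigenvalue (Rp : R) (lam : C) : Prop :=
  exists g, eigenfunction Rp lam g /\
    (forall h, eigenfunction Rp lam h -> exists k : C, forall x, h x = Cmult k (g x)) /\
    ~ (exists h, solves Rp lam g h).

(* Main.v *)
Require Import Defs.
From Stdlib Require Import Reals Lra Classical.
From Stdlib Require Import FunctionalExtensionality IndefiniteDescription Ranalysis5.
From Coquelicot Require Import Coquelicot Complex.
Open Scope R_scope.

(** Write [lam = m^2] with [Re m > 0].  Solving the equation piecewise, with
    decaying exponentials outside [[-1, 1]], the odd part of an eigenfunction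
    is ruled out by [e^m <> 1], and the jump conditions on the even part reduce
    to the characteristic equation [e^m - 1 + r m = 0]; a Jordan chain would
    require in addition that the derivative [e^m + r] vanishes.

    For [|r| <= 1] and [|Im m| < Re m] there is no root because
    [|1 - r m|^2 <= 1 + 2 x + 2 x^2 < e^(2 x)] with [x = Re m].  For
    [1 < r <= R0] the same comparison of moduli confines the roots to
    [x < 9/2], so that [y = Im m], taken nonnegative by conjugation, lies in
    [(PI, 3 PI / 2)].  Eliminating [x], the characteristic equation becomes
    [K y = 1 / r - ln r] with [K y = - y cot y + ln (- y / sin y)] strictly
    increasing, whence [y >= a0]; then [e^x (cos y - sin y) = 1 - r (x - y) < 1]
    yields [x < a0 <= y].  The same function [K] parametrises the crossing
    branch: [y = K^-1 (1 / r - ln r)]. *)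

(** * Functions of a real variable with complex values *)

Lemma is_derive_fst (f : R -> C) (x : R) (l : C) :
  is_derive f x l -> is_derive (fun t => fst (f t)) x (fst l).
Proof.
  intros H.
  apply (filterdiff_comp' f (fun z : C => fst z) x _ (fun z : C => fst z) H).
  apply filterdiff_linear, is_linear_fst.
Qed.

Lemma is_derive_snd (f : R -> C) (x : R) (l : C) :
  is_derive f x l -> is_derive (fun t => snd (f t)) x (snd l).
Proof.
  intros H.
  apply (filterdiff_comp' f (fun z : C => snd z) x _ (fun z : C => snd z) H).
  apply filterdiff_linear, is_linear_snd.
Qed.

Lemma is_derive_pair (f : R -> C) (x : R) (l : C) :
  is_derive (fun t => fst (f t)) x (fst l) ->
  is_derive (fun t => snd (f t)) x (snd l) -> is_derive f x l.
Proof.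
  intros H1 H2.
  pose proof (is_derive_scal_l (V := C_R_NormedModule) _ _ _ ((1, 0) : C) H1) as K1.
  pose proof (is_derive_scal_l (V := C_R_NormedModule) _ _ _ ((0, 1) : C) H2) as K2.
  pose proof (is_derive_plus _ _ _ _ _ K1 K2) as K.
  assert (E : forall z : C, (fst z * 1 + snd z * 0, fst z * 0 + snd z * 1) = z).
  { intros [u v]; simpl; f_equal; ring. }
  rewrite <- (E l).
  eapply is_derive_ext; [ | exact K].
  intros t; exact (E (f t)).
Qed.

Lemma is_derive_C_plus (f g : R -> C) (x : R) (lf lg : C) :
  is_derive f x lf -> is_derive g x lg ->
  is_derive (fun t => Cplus (f t) (g t)) x (Cplus lf lg).
Proof. intros H1 H2; exact (is_derive_plus _ _ _ _ _ H1 H2). Qed.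

Lemma is_derive_C_opp (f : R -> C) (x : R) (lf : C) :
  is_derive f x lf -> is_derive (fun t => Copp (f t)) x (Copp lf).
Proof. intros H1; exact (is_derive_opp _ _ _ H1). Qed.

Lemma is_derive_C_minus (f g : R -> C) (x : R) (lf lg : C) :
  is_derive f x lf -> is_derive g x lg ->
  is_derive (fun t => Cminus (f t) (g t)) x (Cminus lf lg).
Proof. intros H1 H2; apply is_derive_C_plus, is_derive_C_opp; assumption. Qed.

Lemma is_derive_C_mult (f g : R -> C) (x : R) (lf lg : C) :
  is_derive f x lf -> is_derive g x lg ->
  is_derive (fun t => Cmult (f t) (g t)) x (Cplus (Cmult lf (g x)) (Cmult (f x) lg)).
Proof.
  intros Hf Hg.
  pose proof (is_derive_fst _ _ _ Hf) as F1. pose proof (is_derive_snd _ _ _ Hf) as F2.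
  pose proof (is_derive_fst _ _ _ Hg) as G1. pose proof (is_derive_snd _ _ _ Hg) as G2.
  apply is_derive_pair.
  - simpl.
    replace (_ + _) with
      ((fst lf * fst (g x) + fst (f x) * fst lg)
        - (snd lf * snd (g x) + snd (f x) * snd lg)) by ring.
    apply (is_derive_minus (K := R_AbsRing) (V := R_NormedModule));
    apply (is_derive_mult (K := R_AbsRing)); auto; intros; apply Rmult_comm.
  - simpl.
    replace (_ + _) with
      ((fst lf * snd (g x) + fst (f x) * snd lg)
        + (snd lf * fst (g x) + snd (f x) * fst lg)) by ring.
    apply (is_derive_plus (K := R_AbsRing) (V := R_NormedModule));
    apply (is_derive_mult (K := R_AbsRing)); auto; intros; apply Rmult_comm.
Qed.

Lemma is_derive_C_const (k : C) (x : R) : is_derive (fun _ : R => k) x (RtoC 0).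
Proof. exact (is_derive_const (V := C_R_NormedModule) k x). Qed.

Lemma is_derive_RtoC (x : R) : is_derive RtoC x (RtoC 1).
Proof. apply is_derive_pair; simpl; auto_derive; auto. Qed.

(** * Complex exponential and hyperbolic functions *)

Definition cexp (z : C) : C := (exp (fst z) * cos (snd z), exp (fst z) * sin (snd z)).

Lemma cexp_0 : cexp (RtoC 0) = RtoC 1.
Proof. unfold cexp, RtoC; simpl. rewrite exp_0, cos_0, sin_0. f_equal; ring. Qed.

Lemma cexp_plus (z w : C) : cexp (Cplus z w) = Cmult (cexp z) (cexp w).
Proof.
  unfold cexp, Cmult; simpl. rewrite exp_plus, cos_plus, sin_plus. f_equal; ring.
Qed.

Lemma cexp_opp_mult (z : C) : Cmult (cexp z) (cexp (Copp z)) = RtoC 1.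
Proof. rewrite <- cexp_plus, <- cexp_0. f_equal. ring. Qed.

Lemma Cmod_cexp (z : C) : Cmod (cexp z) = exp (Re z).
Proof.
  unfold Cmod, cexp, Re; simpl.
  transitivity (sqrt (Rsqr (exp (fst z)))).
  - f_equal. pose proof (sin2_cos2 (snd z)) as H. unfold Rsqr in *.
    transitivity (exp (fst z) * exp (fst z) * (sin (snd z) * sin (snd z) + cos (snd z) * cos (snd z)));
      [ ring | rewrite H; ring].
  - apply sqrt_Rsqr, Rlt_le, exp_pos.
Qed.

Lemma is_derive_cexp (m : C) (x : R) :
  is_derive (fun t : R => cexp (Cmult m (RtoC t))) x (Cmult m (cexp (Cmult m (RtoC x)))).
Proof.
  apply is_derive_pair; unfold cexp; simpl; auto_derive; auto; unfold Rminus; ring.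
Qed.

Lemma is_derive_C_continuous (f : R -> C) (x : R) (l : C) :
  is_derive f x l -> continuous f x.
Proof.
  intros H. apply (ex_derive_continuous (V := C_R_NormedModule)). now exists l.
Qed.

Definition cch (m : C) (x : R) : C :=
  Cmult (RtoC (/ 2)) (Cplus (cexp (Cmult m (RtoC x))) (cexp (Cmult (Copp m) (RtoC x)))).

Definition csh (m : C) (x : R) : C :=
  Cmult (RtoC (/ 2)) (Cminus (cexp (Cmult m (RtoC x))) (cexp (Cmult (Copp m) (RtoC x)))).

Lemma two_neq_0 : RtoC 2 <> RtoC 0.
Proof. intros H. apply RtoC_inj in H. lra. Qed.

Lemma half_C : RtoC (/ 2) = Cinv (RtoC 2).
Proof. rewrite RtoC_inv; auto; lra. Qed.

Lemma is_derive_cch (m : C) (x : R) : is_derive (cch m) x (Cmult m (csh m x)).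
Proof.
  replace (Cmult m (csh m x)) with
    (Cplus (Cmult (RtoC 0) (Cplus (cexp (Cmult m (RtoC x))) (cexp (Cmult (Copp m) (RtoC x)))))
       (Cmult (RtoC (/ 2)) (Cplus (Cmult m (cexp (Cmult m (RtoC x))))
          (Cmult (Copp m) (cexp (Cmult (Copp m) (RtoC x))))))) by (unfold csh; ring).
  apply (is_derive_C_mult (fun _ => RtoC (/ 2)) (fun t : R =>
    Cplus (cexp (Cmult m (RtoC t))) (cexp (Cmult (Copp m) (RtoC t)))));
    [apply is_derive_C_const | apply is_derive_C_plus; apply is_derive_cexp].
Qed.

Lemma is_derive_csh (m : C) (x : R) : is_derive (csh m) x (Cmult m (cch m x)).
Proof.
  replace (Cmult m (cch m x)) with
    (Cplus (Cmult (RtoC 0) (Cminus (cexp (Cmult m (RtoC x))) (cexp (Cmult (Copp m) (RtoC x)))))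
       (Cmult (RtoC (/ 2)) (Cminus (Cmult m (cexp (Cmult m (RtoC x))))
          (Cmult (Copp m) (cexp (Cmult (Copp m) (RtoC x))))))) by (unfold cch; ring).
  apply (is_derive_C_mult (fun _ => RtoC (/ 2)) (fun t : R =>
    Cminus (cexp (Cmult m (RtoC t))) (cexp (Cmult (Copp m) (RtoC t)))));
    [apply is_derive_C_const | apply is_derive_C_minus; apply is_derive_cexp].
Qed.

Lemma cch_0 (m : C) : cch m 0 = RtoC 1.
Proof.
  unfold cch. replace (Cmult m (RtoC 0)) with (RtoC 0) by ring.
  replace (Cmult (Copp m) (RtoC 0)) with (RtoC 0) by ring.
  rewrite cexp_0, half_C. field.
Qed.

Lemma csh_0 (m : C) : csh m 0 = RtoC 0.
Proof.
  unfold csh. replace (Cmult m (RtoC 0)) with (RtoC 0) by ring.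
  replace (Cmult (Copp m) (RtoC 0)) with (RtoC 0) by ring.
  ring.
Qed.

Lemma cch_opp (m : C) (x : R) : cch m (- x) = cch m x.
Proof.
  unfold cch. rewrite RtoC_opp.
  replace (Cmult m (Copp x)) with (Cmult (Copp m) x) by ring.
  replace (Cmult (Copp m) (Copp x)) with (Cmult m x) by ring. ring.
Qed.

Lemma csh_opp (m : C) (x : R) : csh m (- x) = Copp (csh m x).
Proof.
  unfold csh. rewrite RtoC_opp.
  replace (Cmult m (Copp x)) with (Cmult (Copp m) x) by ring.
  replace (Cmult (Copp m) (Copp x)) with (Cmult m x) by ring. ring.
Qed.

Lemma cch_plus_csh (m : C) : Cplus (cch m 1) (csh m 1) = cexp m.
Proof.
  unfold cch, csh. replace (Cmult m (RtoC 1)) with m by ring.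
  rewrite half_C. field.
Qed.

(** * Bounded solutions on each side of the breakpoints *)

(** For [s = m] and [s = -m] the first integral [e^(s x) (k' - s k)] has zero derivative, hence is
    constant on the order-convex set [I]; the two constants determine [k] and [k']. *)
Lemma ode_general_solution (I : R -> Prop) (m : C) (k k1 k2 : R -> C) (x0 : R) :
  (forall x y z, I x -> I z -> x <= y <= z -> I y) -> I x0 -> m <> RtoC 0 ->
  (forall x, I x -> is_derive k x (k1 x) /\ is_derive k1 x (k2 x) /\
     k2 x = Cmult (Cmult m m) (k x)) ->
  exists al be : C, forall x, I x ->
    k x = Cplus (Cmult al (cexp (Cmult m (RtoC x)))) (Cmult be (cexp (Cmult (Copp m) (RtoC x)))) /\
    k1 x = Cmult m (Cminus (Cmult al (cexp (Cmult m (RtoC x))))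
                      (Cmult be (cexp (Cmult (Copp m) (RtoC x))))).
Proof.
  intros HI Hx0 Hm Hk.
  assert (Hinv : forall s : C, Cmult s s = Cmult m m -> forall x, I x ->
    Cmult (cexp (Cmult s (RtoC x))) (Cminus (k1 x) (Cmult s (k x))) =
    Cmult (cexp (Cmult s (RtoC x0))) (Cminus (k1 x0) (Cmult s (k x0)))).
  { intros s Hs.
    assert (D : forall x, I x -> is_derive
      (fun x => Cmult (cexp (Cmult s (RtoC x))) (Cminus (k1 x) (Cmult s (k x)))) x (RtoC 0)).
    { intros x Ix. destruct (Hk x Ix) as (D1 & D2 & E).
      replace (RtoC 0) with
       (Cplus (Cmult (Cmult s (cexp (Cmult s (RtoC x)))) (Cminus (k1 x) (Cmult s (k x))))
          (Cmult (cexp (Cmult s (RtoC x)))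
             (Cminus (k2 x) (Cplus (Cmult (RtoC 0) (k x)) (Cmult s (k1 x)))))).
      2:{ rewrite E, <- Hs. ring. }
      apply (is_derive_C_mult (fun t : R => cexp (Cmult s (RtoC t)))
        (fun t => Cminus (k1 t) (Cmult s (k t)))); [apply is_derive_cexp | ].
      apply is_derive_C_minus; [exact D2 | ].
      apply (is_derive_C_mult (fun _ => s)); [apply is_derive_C_const | exact D1]. }
    intros x Ix.
    destruct (Rtotal_order x x0) as [L | [-> | L]]; [ | reflexivity | symmetry ];
    refine (eq_is_derive (V := C_R_NormedModule) _ _ _ _ L); intros t Ht; apply D;
    [apply (HI x t x0) | apply (HI x0 t x)]; auto. }
  set (P := Cmult (cexp (Cmult m (RtoC x0))) (Cminus (k1 x0) (Cmult m (k x0)))).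
  set (Q := Cmult (cexp (Cmult (Copp m) (RtoC x0))) (Cminus (k1 x0) (Cmult (Copp m) (k x0)))).
  exists (Cdiv Q (Cmult (RtoC 2) m)), (Copp (Cdiv P (Cmult (RtoC 2) m))).
  intros x Ix.
  assert (HP := Hinv m eq_refl x Ix). fold P in HP.
  assert (HQ := Hinv (Copp m) ltac:(ring) x Ix). fold Q in HQ.
  rewrite <- HP, <- HQ.
  assert (E : Cmult (cexp (Cmult m (RtoC x))) (cexp (Cmult (Copp m) (RtoC x))) = RtoC 1).
  { replace (Cmult (Copp m) (RtoC x)) with (Copp (Cmult m (RtoC x))) by ring.
    apply cexp_opp_mult. }
  set (u := cexp (Cmult m (RtoC x))) in *.
  set (v := cexp (Cmult (Copp m) (RtoC x))) in *.
  pose proof two_neq_0 as H2.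
  split.
  - transitivity (Cmult (Cmult u v) (k x)); [rewrite E; ring | field; auto].
  - transitivity (Cmult (Cmult u v) (k1 x)); [rewrite E; ring | field; auto].
Qed.

(** Follows from [r t <= e^(r t)]. It bounds the resonant term [(x - 1) e^(-m (x - 1))] that a
    Jordan chain produces outside [[-1, 1]]. *)
Lemma mult_exp_opp_bound (r t : R) : 0 < r -> 0 <= t -> t * exp (- (r * t)) <= / r.
Proof.
  intros Hr Ht.
  apply (Rmult_le_reg_l (exp (r * t))); [apply exp_pos | ].
  replace (exp (r * t) * (t * exp (- (r * t)))) with (t * exp (r * t + - (r * t)))
    by (rewrite exp_plus; ring).
  rewrite Rplus_opp_r, exp_0.
  apply (Rmult_le_reg_l r); [exact Hr | ].
  replace (r * (exp (r * t) * / r)) with (exp (r * t)) by (field; lra).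
  pose proof (exp_ineq1_le (r * t)). nra.
Qed.

(** Since [e^t >= 1 + t], a nonzero [al] would push the modulus above [M] as soon as
    [Re m * x >= M / |al|]. *)
Lemma bounded_growing_exp (m al : C) (M : R) :
  0 < Re m -> (forall x, 1 < x -> Cmod (Cmult al (cexp (Cmult m (RtoC x)))) <= M) -> al = RtoC 0.
Proof.
  intros Hm H. apply Cmod_eq_0.
  destruct (Rle_lt_or_eq_dec _ _ (Cmod_ge_0 al)) as [Hp | <-]; [exfalso | reflexivity].
  set (x := Rmax 2 (M / Cmod al / Re m)).
  assert (Hx : 2 <= x) by apply Rmax_l.
  assert (Hx' : M / Cmod al / Re m <= x) by apply Rmax_r.
  specialize (H x ltac:(lra)).
  rewrite Cmod_mult, Cmod_cexp in H.
  replace (Re (Cmult m (RtoC x))) with (Re m * x) in H by (unfold Re; simpl; ring).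
  pose proof (exp_ineq1_le (Re m * x)) as E.
  assert (M / Cmod al <= Re m * x).
  { apply (Rmult_le_compat_l (Re m)) in Hx'; [ | lra].
    replace (Re m * (M / Cmod al / Re m)) with (M / Cmod al) in Hx' by (field; lra). exact Hx'. }
  assert (M <= Cmod al * (Re m * x)).
  { apply (Rmult_le_compat_l (Cmod al)) in H0; [ | lra].
    replace (Cmod al * (M / Cmod al)) with M in H0 by (field; lra). exact H0. }
  nra.
Qed.

Lemma is_derive_cexp_shift (m : C) (p x : R) :
  is_derive (fun t : R => cexp (Cmult m (RtoC (t - p)))) x (Cmult m (cexp (Cmult m (RtoC (x - p))))).
Proof.
  apply is_derive_pair; unfold cexp; simpl; auto_derive; auto; unfold Rminus; ring.
Qed.

Lemma is_derive_C_eq (f : R -> C) (x : R) (l l' : C) :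
  is_derive f x l -> l = l' -> is_derive f x l'.
Proof. intros H <-; exact H. Qed.

(** Differentiation directed by the shape of the function; [derive_C] leaves only the equality of
    the assembled derivative with the claimed one. *)
Ltac derive_C_aux :=
  match goal with
  | |- is_derive (fun _ => ?k) _ _ => apply (is_derive_C_const k)
  | |- is_derive (fun t => Cplus (@?f t) (@?g t)) _ _ => apply (is_derive_C_plus f g); derive_C_aux
  | |- is_derive (fun t => Cminus (@?f t) (@?g t)) _ _ => apply (is_derive_C_minus f g); derive_C_aux
  | |- is_derive (fun t => Copp (@?f t)) _ _ => apply (is_derive_C_opp f); derive_C_aux
  | |- is_derive (fun t => Cmult (@?f t) (@?g t)) _ _ => apply (is_derive_C_mult f g); derive_C_aux
  | |- is_derive (fun t => cexp (Cmult ?m (RtoC t))) _ _ => apply (is_derive_cexp m)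
  | |- is_derive (fun t => cexp (Cmult ?m (RtoC (t - ?p)))) _ _ => apply (is_derive_cexp_shift m p)
  | |- is_derive (fun t => cch ?m t) _ _ => apply (is_derive_cch m)
  | |- is_derive (fun t => csh ?m t) _ _ => apply (is_derive_csh m)
  | |- is_derive (fun t => RtoC t) _ _ => apply is_derive_RtoC
  | |- is_derive (fun t => RtoC (t - ?p)) _ _ =>
      apply (is_derive_C_eq _ _ (Cminus (RtoC 1) (RtoC 0)));
      [ apply (is_derive_ext (V := C_R_NormedModule) (fun t => Cminus (RtoC t) (RtoC p)));
        [ intros; symmetry; apply RtoC_minus
        | apply (is_derive_C_minus RtoC (fun _ => RtoC p));
          [apply is_derive_RtoC | apply is_derive_C_const] ]
      | reflexivity ]
  | _ => eassumption
  end.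
Ltac derive_C := eapply is_derive_C_eq; [derive_C_aux | ].

(** Used to read off one-sided limits at [1] from explicit formulas that are known only on one side
    of that point. *)
Lemma limit_eq (F : (R -> Prop) -> Prop) {FF : ProperFilter' F} (f g : R -> C) (p : R) (l : C) :
  filter_le F (locally p) -> F (fun x => f x = g x) -> continuous g p ->
  filterlim f F (locally l) -> l = g p.
Proof.
  intros HF E Hg Hf.
  apply (filterlim_locally_unique (V := C_R_NormedModule) (F := F) f l (g p)); [exact Hf | ].
  apply (filterlim_ext_loc g).
  - destruct FF as [_ FF']. apply (filter_imp (fun x => f x = g x)); auto.
  - eapply filterlim_filter_le_1; [exact HF | exact Hg].
Qed.

Lemma at_left_le_locally (p : R) : filter_le (at_left p) (locally p).
Proof. intros P H. unfold at_left, within. apply filter_imp with (2 := H). auto. Qed.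

Lemma at_right_le_locally (p : R) : filter_le (at_right p) (locally p).
Proof. intros P H. unfold at_right, within. apply filter_imp with (2 := H). auto. Qed.

Lemma at_left_interval (p : R) (P : R -> Prop) (a : R) :
  a < p -> (forall x, a < x < p -> P x) -> at_left p P.
Proof.
  intros Ha H. unfold at_left, within.
  apply filter_imp with (P := fun x => a < x).
  - intros x Hx Hx'. apply H. split; assumption.
  - apply (open_gt a p Ha).
Qed.

Lemma at_right_interval (p : R) (P : R -> Prop) (b : R) :
  p < b -> (forall x, p < x < b -> P x) -> at_right p P.
Proof.
  intros Hb H. unfold at_right, within.
  apply filter_imp with (P := fun x => x < b).
  - intros x Hx Hx'. apply H. split; assumption.
  - apply (open_lt b p Hb).
Qed.

(* Solves [h'' - m^2 h = c + ka (cosh (m x) - 1)], [h 0 = 0], [h' 0 = b]; the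
   forcing [ka] is [0] for eigenfunctions and [1] for Jordan chains. *)
Definition inner_sol (m ka b c : C) (x : R) : C :=
  Cplus (Cplus (Cmult (Cdiv ka (Cmult (RtoC 2) m)) (Cmult (RtoC x) (csh m x)))
               (Cmult (Cdiv b m) (csh m x)))
        (Cmult (Cdiv (Cminus c ka) (Cmult m m)) (Cminus (cch m x) (RtoC 1))).

Definition inner_sol1 (m ka b c : C) (x : R) : C :=
  Cplus (Cplus (Cmult (Cdiv ka (Cmult (RtoC 2) m))
                  (Cplus (csh m x) (Cmult m (Cmult (RtoC x) (cch m x)))))
               (Cmult b (cch m x)))
        (Cmult (Cdiv (Cminus c ka) m) (csh m x)).

Definition inner_sol2 (m ka b c : C) (x : R) : C :=
  Cplus (Cplus (Cmult (Cdiv ka (Cmult (RtoC 2) m))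
                  (Cplus (Cmult (Cmult (RtoC 2) m) (cch m x))
                     (Cmult (Cmult m m) (Cmult (RtoC x) (csh m x)))))
               (Cmult (Cmult b m) (csh m x)))
        (Cmult (Cminus c ka) (cch m x)).

Lemma is_derive_inner_sol (m ka b c : C) (x : R) : m <> RtoC 0 ->
  is_derive (inner_sol m ka b c) x (inner_sol1 m ka b c x).
Proof.
  intros Hm. unfold inner_sol, inner_sol1. derive_C. field. auto using two_neq_0.
Qed.

Lemma is_derive_inner_sol1 (m ka b c : C) (x : R) : m <> RtoC 0 ->
  is_derive (inner_sol1 m ka b c) x (inner_sol2 m ka b c x).
Proof.
  intros Hm. unfold inner_sol1, inner_sol2. derive_C. field. auto using two_neq_0.
Qed.

Lemma Re_pos_neq_0 (m : C) : 0 < Re m -> m <> RtoC 0.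
Proof. intros H ->. unfold Re in H; simpl in H. lra. Qed.

(** Inside, the solution is fixed by its data at [0]; outside, boundedness removes [e^(m x)] and
    continuity at [1] fixes the remaining amplitude. The forcing is [ka] times the even function
    [mode m] defined below, so the left half follows by applying the lemma to [h (- x)]. *)
Lemma right_side (m ka b c dL dR : C) (h h1 h2 : R -> C) (M : R) :
  0 < Re m ->
  (forall x, -1 < x < 1 -> is_derive h x (h1 x) /\ is_derive h1 x (h2 x) /\
     Cminus (Cminus (h2 x) c) (Cmult (Cmult m m) (h x)) = Cmult ka (Cminus (cch m x) (RtoC 1))) ->
  (forall x, 1 < x -> is_derive h x (h1 x) /\ is_derive h1 x (h2 x) /\
     Cminus (h2 x) (Cmult (Cmult m m) (h x)) =
       Cmult ka (Cmult (Cminus (cch m 1) (RtoC 1)) (cexp (Cmult (Copp m) (RtoC (x - 1)))))) ->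
  (forall x, Cmod (h x) <= M) -> continuous h 1 -> h 0 = RtoC 0 -> h1 0 = b ->
  filterlim h1 (at_left 1) (locally dL) -> filterlim h1 (at_right 1) (locally dR) ->
  (forall x, -1 < x <= 1 -> h x = inner_sol m ka b c x) /\
  (forall x, 1 <= x -> h x =
     Cmult (Cminus (inner_sol m ka b c 1)
              (Cmult (Cdiv (Cmult ka (Cminus (cch m 1) (RtoC 1))) (Cmult (RtoC 2) m)) (RtoC (x - 1))))
       (cexp (Cmult (Copp m) (RtoC (x - 1))))) /\
  dL = inner_sol1 m ka b c 1 /\
  dR = Cminus (Copp (Cmult m (inner_sol m ka b c 1)))
        (Cdiv (Cmult ka (Cminus (cch m 1) (RtoC 1))) (Cmult (RtoC 2) m)).
Proof.
  intros Hre Hin Hout HM Hcont Hh0 Hh10 HL HR.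
  pose proof (Re_pos_neq_0 m Hre) as Hm. pose proof two_neq_0 as H2.
  (* The difference from [inner_sol] solves the homogeneous equation with zero data at [0], so both
     of its exponential coefficients vanish. *)
  assert (Inner : forall x, -1 < x < 1 -> h x = inner_sol m ka b c x /\ h1 x = inner_sol1 m ka b c x).
  { destruct (ode_general_solution (fun x => -1 < x < 1) m
      (fun x => Cminus (h x) (inner_sol m ka b c x)) (fun x => Cminus (h1 x) (inner_sol1 m ka b c x))
      (fun x => Cminus (h2 x) (inner_sol2 m ka b c x)) 0) as (al & be & H); auto.
    - intros; lra.
    - lra.
    - intros x Hx. destruct (Hin x Hx) as (D1 & D2 & E).
      split; [ | split].
      + apply is_derive_C_minus; auto using is_derive_inner_sol.
      + apply is_derive_C_minus; auto using is_derive_inner_sol1.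
      + replace (h2 x) with (Cplus (Cplus c (Cmult (Cmult m m) (h x))) (Cmult ka (Cminus (cch m x) (RtoC 1)))).
        2:{ rewrite <- E. ring. }
        unfold inner_sol, inner_sol2. field. auto.
    - destruct (H 0 ltac:(lra)) as [E0 E1].
      rewrite Hh0 in E0. rewrite Hh10 in E1.
      unfold inner_sol, inner_sol1 in E0, E1. rewrite csh_0, cch_0 in E0, E1.
      replace (Cmult m (RtoC 0)) with (RtoC 0) in E0, E1 by ring.
      replace (Cmult (Copp m) (RtoC 0)) with (RtoC 0) in E0, E1 by ring.
      rewrite cexp_0 in E0, E1.
      assert (S : Cplus al be = RtoC 0).
      { transitivity (Cplus (Cmult al (RtoC 1)) (Cmult be (RtoC 1)));
        [ring | rewrite <- E0; ring]. }
      assert (D : Cmult m (Cminus al be) = RtoC 0).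
      { transitivity (Cmult m (Cminus (Cmult al (RtoC 1)) (Cmult be (RtoC 1))));
        [ring | rewrite <- E1; ring]. }
      assert (al = RtoC 0).
      { transitivity (Cdiv (Cplus (Cplus al be) (Cdiv (Cmult m (Cminus al be)) m)) (RtoC 2)).
        - field. auto.
        - rewrite S, D. field. auto. }
      assert (be = RtoC 0). { rewrite H0 in S. rewrite <- S. ring. }
      subst al be.
      intros x Hx. destruct (H x Hx) as [F0 F1]. split.
      + transitivity (Cplus (Cminus (h x) (inner_sol m ka b c x)) (inner_sol m ka b c x));
        [ring | rewrite F0; ring].
      + transitivity (Cplus (Cminus (h1 x) (inner_sol1 m ka b c x)) (inner_sol1 m ka b c x));
        [ring | rewrite F1; ring]. }
  assert (At1 : h 1 = inner_sol m ka b c 1).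
  { apply (limit_eq (at_left 1) h (inner_sol m ka b c) 1 (h 1)).
    - apply at_left_le_locally.
    - apply at_left_interval with (a := -1); [lra | ]. intros x Hx. now apply Inner.
    - eapply is_derive_C_continuous, is_derive_inner_sol, Hm.
    - eapply filterlim_filter_le_1; [apply at_left_le_locally | exact Hcont]. }
  assert (EdL : dL = inner_sol1 m ka b c 1).
  { apply (limit_eq (at_left 1) h1 (inner_sol1 m ka b c) 1 dL); [ | | | exact HL].
    - apply at_left_le_locally.
    - apply at_left_interval with (a := -1); [lra | ]. intros x Hx. now apply Inner.
    - eapply is_derive_C_continuous, is_derive_inner_sol1, Hm. }
  (* The forcing is itself a decaying solution of the homogeneous equation;
     [- q (x - 1) e^(-m (x - 1))] is a particular solution for this resonance. *)
  set (q := Cdiv (Cmult ka (Cminus (cch m 1) (RtoC 1))) (Cmult (RtoC 2) m)) in *.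
  set (v := fun x => cexp (Cmult (Copp m) (RtoC (x - 1)))).
  assert (Hv : forall x, cexp (Cmult (Copp m) (RtoC x)) = Cmult (cexp (Copp m)) (v x)).
  { intros x. unfold v. rewrite <- cexp_plus. f_equal. rewrite RtoC_minus. ring. }
  assert (Outer : exists be, forall x, 1 < x ->
     h x = Cmult (Cminus be (Cmult q (RtoC (x - 1)))) (v x) /\
     h1 x = Cmult (Cminus (Cmult (Copp m) (Cminus be (Cmult q (RtoC (x - 1))))) q) (v x)).
  { destruct (ode_general_solution (fun x => 1 < x) m
      (fun x => Cplus (h x) (Cmult (Cmult q (RtoC (x - 1))) (v x)))
      (fun x => Cplus (h1 x) (Cmult (Cminus q (Cmult m (Cmult q (RtoC (x - 1))))) (v x)))
      (fun x => Cplus (h2 x) (Cmult (Cminus (Cmult (Cmult m m) (Cmult q (RtoC (x - 1))))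
           (Cmult (Cmult (RtoC 2) m) q)) (v x))) 2) as (al & be & H); auto.
    - intros; lra.
    - lra.
    - intros x Hx. destruct (Hout x Hx) as (D1 & D2 & E). unfold v.
      split; [ | split].
      + derive_C. ring.
      + derive_C. ring.
      + replace (h2 x) with (Cplus (Cmult (Cmult m m) (h x)) (Cminus (h2 x) (Cmult (Cmult m m) (h x)))) by ring.
        rewrite E. unfold q. field. auto.
    (* All other terms are bounded for [x > 1], so the growing exponential cannot be present. *)
    - assert (al = RtoC 0).
      { apply (bounded_growing_exp m al (M + Cmod q * / Re m + Cmod be)); [exact Hre | ].
        intros x Hx. destruct (H x Hx) as [H' _].
        replace (Cmult al (cexp (Cmult m (RtoC x)))) with
          (Cplus (Cplus (h x) (Cmult (Cmult q (RtoC (x - 1))) (v x)))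
            (Copp (Cmult be (cexp (Cmult (Copp m) (RtoC x)))))).
        2:{ rewrite H'. ring. }
        eapply Rle_trans; [apply Cmod_triangle | ].
        apply Rplus_le_compat; [eapply Rle_trans; [apply Cmod_triangle | apply Rplus_le_compat;
          [apply HM | ]] | ].
        - unfold v. rewrite !Cmod_mult, Cmod_cexp, Cmod_R, Rabs_pos_eq by lra.
          rewrite Rmult_assoc. apply Rmult_le_compat_l; [apply Cmod_ge_0 | ].
          replace (Re (Cmult (Copp m) (RtoC (x - 1)))) with (- (Re m * (x - 1)))
            by (unfold Re; simpl; ring).
          apply mult_exp_opp_bound; lra.
        - rewrite Cmod_opp, Cmod_mult, Cmod_cexp.
          replace (Re (Cmult (Copp m) (RtoC x))) with (- (Re m * x)) by (unfold Re; simpl; ring).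
          rewrite <- (Rmult_1_r (Cmod be)) at 2.
          apply Rmult_le_compat_l; [apply Cmod_ge_0 | ].
          rewrite <- exp_0. apply Rlt_le, exp_increasing. nra. }
      subst al.
      exists (Cmult be (cexp (Copp m))). intros x Hx. destruct (H x Hx) as [F0 F1].
      rewrite Hv in F0, F1. split.
      + transitivity (Cminus (Cplus (h x) (Cmult (Cmult q (RtoC (x - 1))) (v x))) (Cmult (Cmult q (RtoC (x - 1))) (v x))); [ring | ].
        rewrite F0. ring.
      + transitivity (Cminus (Cplus (h1 x) (Cmult (Cminus q (Cmult m (Cmult q (RtoC (x - 1))))) (v x)))
           (Cmult (Cminus q (Cmult m (Cmult q (RtoC (x - 1))))) (v x))); [ring | ].
        rewrite F1. ring. }
  destruct Outer as [be Outer].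
  assert (Hv1 : v 1 = RtoC 1).
  { unfold v. rewrite <- cexp_0. f_equal. rewrite RtoC_minus. ring. }
  assert (Ebe : h 1 = be).
  { transitivity (Cmult (Cminus be (Cmult q (RtoC (1 - 1)))) (v 1)).
    - apply (limit_eq (at_right 1) h (fun x => Cmult (Cminus be (Cmult q (RtoC (x - 1)))) (v x)) 1 (h 1)).
      + apply at_right_le_locally.
      + apply at_right_interval with (b := 2); [lra | ]. intros x Hx. now apply Outer.
      + unfold v. eapply is_derive_C_continuous. derive_C_aux.
      + eapply filterlim_filter_le_1; [apply at_right_le_locally | exact Hcont].
    - rewrite Hv1, RtoC_minus. ring. }
  rewrite At1 in Ebe.
  repeat split.
  - intros x Hx. destruct (Req_dec x 1) as [-> | Hn]; [exact At1 | apply Inner; lra].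
  - intros x Hx. rewrite Ebe. destruct (Req_dec x 1) as [-> | Hn]; [ | apply Outer; lra].
    fold (v 1). rewrite Hv1, RtoC_minus, At1, Ebe. ring.
  - exact EdL.
  - rewrite Ebe. transitivity (Cmult (Cminus (Cmult (Copp m) (Cminus be (Cmult q (RtoC (1 - 1))))) q) (v 1)).
    + apply (limit_eq (at_right 1) h1 (fun x => Cmult (Cminus (Cmult (Copp m) (Cminus be (Cmult q (RtoC (x - 1))))) q) (v x)) 1 dR); [ | | | exact HR].
      * apply at_right_le_locally.
      * apply at_right_interval with (b := 2); [lra | ]. intros x Hx. now apply Outer.
      * unfold v. eapply is_derive_C_continuous. derive_C_aux.
    + rewrite Hv1, RtoC_minus. ring.
Qed.

(** * Eigenfunctions and the characteristic equation *)

Definition pw (f g k : R -> C) (x : R) : C :=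
  if Rlt_dec x (-1) then f x else if Rlt_dec 1 x then k x else g x.

Lemma pw_left (f g k : R -> C) (x : R) : x < -1 -> pw f g k x = f x.
Proof. intros H. unfold pw. destruct (Rlt_dec x (-1)); [reflexivity | lra]. Qed.

Lemma pw_mid (f g k : R -> C) (x : R) : -1 <= x <= 1 -> pw f g k x = g x.
Proof.
  intros H. unfold pw. destruct (Rlt_dec x (-1)); [lra | ].
  destruct (Rlt_dec 1 x); [lra | reflexivity].
Qed.

Lemma pw_right (f g k : R -> C) (x : R) : 1 < x -> pw f g k x = k x.
Proof.
  intros H. unfold pw. destruct (Rlt_dec x (-1)); [lra | ].
  destruct (Rlt_dec 1 x); [reflexivity | lra].
Qed.

Lemma is_derive_pw (f g k f' g' k' : R -> C) (x : R) :
  (forall x, is_derive f x (f' x)) -> (forall x, is_derive g x (g' x)) ->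
  (forall x, is_derive k x (k' x)) -> x <> -1 -> x <> 1 ->
  is_derive (pw f g k) x (pw f' g' k' x).
Proof.
  intros Hf Hg Hk N1 N2.
  destruct (Rlt_le_dec x (-1)) as [L | L]; [ | destruct (Rlt_le_dec 1 x) as [L' | L']].
  - rewrite pw_left by exact L. apply (is_derive_ext_loc f); [ | apply Hf].
    apply (filter_imp (fun t => t < -1)); [ | apply (open_lt _ _ L)].
    intros t Ht. symmetry. now apply pw_left.
  - rewrite pw_right by exact L'. apply (is_derive_ext_loc k); [ | apply Hk].
    apply (filter_imp (fun t => 1 < t)); [ | apply (open_gt _ _ L')].
    intros t Ht. symmetry. now apply pw_right.
  - rewrite pw_mid by lra. apply (is_derive_ext_loc g); [ | apply Hg].
    apply (filter_imp (fun t => -1 < t /\ t < 1)).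
    + intros t Ht. symmetry. apply pw_mid. lra.
    + apply filter_and; [apply (open_gt (-1) x) | apply (open_lt 1 x)]; lra.
Qed.

Lemma continuous_pw (f g k : R -> C) (x : R) :
  (forall x, continuous f x) -> (forall x, continuous g x) -> (forall x, continuous k x) ->
  f (-1) = g (-1) -> k 1 = g 1 -> continuous (pw f g k) x.
Proof.
  intros Hf Hg Hk E1 E2 P HP.
  assert (Aux : forall u : R -> C, continuous u x -> pw f g k x = u x
    -> locally x (fun t => P (u t))).
  { intros u Hu E. rewrite E in HP. exact (Hu P HP). }
  change (locally x (fun t => P (pw f g k t))).
  destruct (Rlt_le_dec x (-1)) as [L | L]; [ | destruct (Rlt_le_dec 1 x) as [L' | L']].
  - apply (filter_imp (fun t => t < -1 /\ P (f t))).
    + intros t [Ht HPt]. now rewrite pw_left.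
    + apply filter_and; [apply (open_lt _ _ L) | ]. apply Aux; auto. now apply pw_left.
  - apply (filter_imp (fun t => 1 < t /\ P (k t))).
    + intros t [Ht HPt]. now rewrite pw_right.
    + apply filter_and; [apply (open_gt _ _ L') | ]. apply Aux; auto. now apply pw_right.
  - destruct (Req_dec x (-1)) as [-> | N1]; [ | destruct (Req_dec x 1) as [-> | N2]].
    + apply (filter_imp (fun t => t < 1 /\ P (f t) /\ P (g t))).
      * intros t [Ht [H1 H2]]. unfold pw. destruct (Rlt_dec t (-1)); auto.
        destruct (Rlt_dec 1 t); [lra | auto].
      * apply filter_and; [apply (open_lt 1 (-1)); lra | apply filter_and; apply Aux; auto].
        -- rewrite pw_mid by lra. auto.
        -- apply pw_mid. lra.
    + apply (filter_imp (fun t => -1 < t /\ P (k t) /\ P (g t))).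
      * intros t [Ht [H1 H2]]. unfold pw. destruct (Rlt_dec t (-1)); [lra | ].
        destruct (Rlt_dec 1 t); auto.
      * apply filter_and; [apply (open_gt (-1) 1); lra | apply filter_and; apply Aux; auto].
        -- rewrite pw_mid by lra. auto.
        -- apply pw_mid. lra.
    + apply (filter_imp (fun t => (-1 < t /\ t < 1) /\ P (g t))).
      * intros t [Ht HPt]. now rewrite pw_mid by lra.
      * apply filter_and; [ | apply Aux; auto; apply pw_mid; lra].
        apply filter_and; [apply (open_gt (-1) x) | apply (open_lt 1 x)]; lra.
Qed.

Lemma pw_one_sided_limits (f g k : R -> C) :
  (forall x, continuous f x) -> (forall x, continuous g x) -> (forall x, continuous k x) ->
  filterlim (pw f g k) (at_left (-1)) (locally (f (-1))) /\
  filterlim (pw f g k) (at_right (-1)) (locally (g (-1))) /\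
  filterlim (pw f g k) (at_left 1) (locally (g 1)) /\
  filterlim (pw f g k) (at_right 1) (locally (k 1)).
Proof.
  intros Hf Hg Hk.
  repeat split.
  - apply (filterlim_ext_loc f);
      [ | eapply filterlim_filter_le_1; [apply at_left_le_locally | apply Hf]].
    apply at_left_interval with (a := -2); [lra | ].
    intros x Hx. symmetry. apply pw_left. lra.
  - apply (filterlim_ext_loc g);
      [ | eapply filterlim_filter_le_1; [apply at_right_le_locally | apply Hg]].
    apply at_right_interval with (b := 1); [lra | ].
    intros x Hx. symmetry. apply pw_mid. lra.
  - apply (filterlim_ext_loc g);
      [ | eapply filterlim_filter_le_1; [apply at_left_le_locally | apply Hg]].
    apply at_left_interval with (a := -1); [lra | ].
    intros x Hx. symmetry. apply pw_mid. lra.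
  - apply (filterlim_ext_loc k);
      [ | eapply filterlim_filter_le_1; [apply at_right_le_locally | apply Hk]].
    apply at_right_interval with (b := 2); [lra | ].
    intros x Hx. symmetry. apply pw_right. lra.
Qed.

(** Every piece is differentiable on the whole line, so the one-sided limits of the derivative at
    the breakpoints are plain values and the jump conditions become two equations between
    numbers. *)
Lemma solves_pw (Rp : R) (lam c : C) (f g k f1 g1 k1 f2 g2 k2 : R -> C) (M : R) :
  (forall x, is_derive f x (f1 x)) -> (forall x, is_derive g x (g1 x)) ->
  (forall x, is_derive k x (k1 x)) ->
  (forall x, is_derive f1 x (f2 x)) -> (forall x, is_derive g1 x (g2 x)) ->
  (forall x, is_derive k1 x (k2 x)) ->
  f (-1) = g (-1) -> k 1 = g 1 -> g 0 = RtoC 0 -> g2 0 = c ->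
  (forall x, x < -1 -> f2 x = Cmult lam (f x)) ->
  (forall x, -1 < x < 1 -> g2 x = Cplus c (Cmult lam (g x))) ->
  (forall x, 1 < x -> k2 x = Cmult lam (k x)) ->
  (forall x, Cmod (pw f g k x) <= M) ->
  Cminus (g1 (-1)) (f1 (-1)) = Cplus (g1 0) (Cmult (RtoC Rp) c) ->
  Cminus (k1 1) (g1 1) = Cplus (Copp (g1 0)) (Cmult (RtoC Rp) c) ->
  solves Rp lam (fun _ => RtoC 0) (pw f g k).
Proof.
  intros Df Dg Dk Df1 Dg1 Dk1 Em Ep E0 Ec Of Og Ok HM JL JR.
  assert (CC : forall u u', (forall x, is_derive u x (u' x)) -> forall x : R, continuous (u : R
    -> C) x).
  { intros u u' H x. eapply is_derive_C_continuous, H. }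
  exists (pw f1 g1 k1), (pw f2 g2 k2).
  refine (conj _ (conj _ (conj _ (conj _ (conj _ _))))).
  - intros x. apply continuous_pw; eauto.
  - rewrite pw_mid by lra. exact E0.
  - exists M. exact HM.
  - intros x N1 N2. split; now apply is_derive_pw.
  - intros x N1 N2. rewrite (pw_mid _ _ _ 0), Ec by lra. unfold chi11.
    destruct (Rlt_dec (-1) x) as [L | L]; [destruct (Rlt_dec x 1) as [L' | L'] | ].
    + rewrite !pw_mid, Og by lra. ring.
    + rewrite !pw_right, Ok by lra. ring.
    + rewrite !pw_left, Of by lra. ring.
  - destruct (pw_one_sided_limits f1 g1 k1) as (H1 & H2 & H3 & H4); eauto.
    exists (f1 (-1)), (g1 (-1)), (g1 1), (k1 1).
    rewrite !(pw_mid _ _ _ 0), Ec by lra. auto 10.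
Qed.

(** The even candidate eigenfunction, normalised by [g''(0) = m^2]: it satisfies the equation away
    from the breakpoints for every [m], and only the jumps constrain [m]. The shift is written
    [x - -1] to fit the pattern of [is_derive_cexp_shift]. *)
Definition mode (m : C) : R -> C :=
  pw (fun x => Cmult (Cminus (cch m 1) (RtoC 1)) (cexp (Cmult m (RtoC (x - -1)))))
     (fun x => Cminus (cch m x) (RtoC 1))
     (fun x => Cmult (Cminus (cch m 1) (RtoC 1)) (cexp (Cmult (Copp m) (RtoC (x - 1))))).

Lemma mode_opp (m : C) (x : R) : mode m (- x) = mode m x.
Proof.
  unfold mode.
  destruct (Rlt_le_dec x (-1)) as [L | L]; [ | destruct (Rlt_le_dec 1 x) as [L' | L']].
  - rewrite pw_right, pw_left by lra. do 2 f_equal. rewrite !RtoC_minus, !RtoC_opp. ring.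
  - rewrite pw_left, pw_right by lra. do 2 f_equal. rewrite !RtoC_minus, !RtoC_opp. ring.
  - rewrite !pw_mid by lra. now rewrite cch_opp.
Qed.

(** The modulus of [e^m] is [e^(Re m) > 1]. *)
Lemma cexp_neq_1 (m : C) : 0 < Re m -> cexp m <> RtoC 1.
Proof.
  intros H E. pose proof (Cmod_cexp m) as K. rewrite E, Cmod_1 in K.
  pose proof (exp_ineq1 (Re m)). lra.
Qed.

(** This factorisation of [2 e^m (cosh m - 1)] shows that [mode m] does not vanish at [1] when
    [e^m <> 1]. *)
Lemma mode_1 (m : C) :
  Cmult (Cmult (RtoC 2) (cexp m)) (mode m 1) =
  Cmult (Cminus (cexp m) (RtoC 1)) (Cminus (cexp m) (RtoC 1)).
Proof.
  unfold mode. rewrite pw_mid by lra. unfold cch.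
  replace (Cmult m (RtoC 1)) with m by ring.
  replace (Cmult (Copp m) (RtoC 1)) with (Copp m) by ring.
  rewrite half_C.
  pose proof (cexp_opp_mult m) as E.
  transitivity (Cplus (Cplus (Cmult (cexp m) (cexp m)) (Cmult (cexp m) (cexp (Copp m))))
     (Copp (Cmult (RtoC 2) (cexp m)))); [field | rewrite E; ring].
Qed.

Lemma exp_le_exp (x y : R) : x <= y -> exp x <= exp y.
Proof. intros [H | ->]; [now apply Rlt_le, exp_increasing | apply Rle_refl]. Qed.

Lemma exp_le_1 (x : R) : x <= 0 -> exp x <= 1.
Proof. intros H. rewrite <- exp_0. now apply exp_le_exp. Qed.

Lemma mode_bound (m : C) : 0 < Re m ->
  exists M, forall x, Cmod (mode m x) <= M.
Proof.
  intros Hm.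
  set (N := Cmod (Cminus (cch m 1) (RtoC 1))).
  assert (HN : 0 <= N) by apply Cmod_ge_0.
  exists (N + (2 * exp (Re m) + 1)).
  pose proof (exp_pos (Re m)) as Hp.
  intros x. unfold mode.
  destruct (Rlt_le_dec x (-1)) as [L | L]; [ | destruct (Rlt_le_dec 1 x) as [L' | L']].
  - rewrite pw_left by lra. rewrite Cmod_mult, Cmod_cexp. fold N.
    assert (exp (Re (Cmult m (RtoC (x - -1)))) <= 1).
    { replace (Re (Cmult m (RtoC (x - -1)))) with (Re m * (x + 1)) by (unfold Re; simpl; ring).
      apply exp_le_1. nra. }
    nra.
  - rewrite pw_right by lra. rewrite Cmod_mult, Cmod_cexp. fold N.
    assert (exp (Re (Cmult (Copp m) (RtoC (x - 1)))) <= 1).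
    { replace (Re (Cmult (Copp m) (RtoC (x - 1)))) with (- (Re m * (x - 1)))
      by (unfold Re; simpl; ring).
      apply exp_le_1. nra. }
    nra.
  - rewrite pw_mid by lra. unfold cch.
    assert (H : forall s : R, Rabs s <= 1 -> Cmod (cexp (Cmult m (RtoC s))) <= exp (Re m)).
    { intros s Hs. rewrite Cmod_cexp. apply exp_le_exp.
      replace (Re (Cmult m (RtoC s))) with (Re m * s) by (unfold Re; simpl; ring).
      apply Rabs_le_between in Hs. nra. }
    unfold Cminus. eapply Rle_trans; [apply Cmod_triangle | ].
    rewrite Cmod_opp, Cmod_1, Cmod_mult, Cmod_R, Rabs_pos_eq by lra.
    replace (Cmult (Copp m) (RtoC x)) with (Cmult m (RtoC (- x))) by (rewrite RtoC_opp; ring).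
    pose proof (Cmod_triangle (cexp (Cmult m (RtoC x))) (cexp (Cmult m (RtoC (- x))))).
    pose proof (H x ltac:(apply Rabs_le_between; lra)).
    pose proof (H (- x) ltac:(apply Rabs_le_between; lra)). lra.
Qed.

(** Here [g'(0) = 0] by evenness, and both jumps of [g'] equal [- m (cosh m - 1 + sinh m) = - m (e^m
    - 1)]; the prescribed value [Rp m^2] is thus the characteristic equation multiplied by [m]. *)
Lemma mode_eigenfunction (Rp : R) (m : C) :
  0 < Re m -> Cplus (Cminus (cexp m) (RtoC 1)) (Cmult (RtoC Rp) m) = RtoC 0 ->
  eigenfunction Rp (Cmult m m) (mode m).
Proof.
  intros Hm Hc. split.
  - destruct (mode_bound m Hm) as [M HM].
    set (E := Cminus (cch m 1) (RtoC 1)) in *.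
    assert (HE : Cplus (Cmult m (Cplus E (csh m 1))) (Cmult (RtoC Rp) (Cmult m m)) = RtoC 0).
    { unfold E. transitivity (Cmult m (Cplus (Cminus (Cplus (cch m 1) (csh m 1)) (RtoC 1)) (Cmult (RtoC Rp) m))); [ring | ].
      rewrite cch_plus_csh, Hc. ring. }
    apply (solves_pw Rp (Cmult m m) (Cmult m m) _ _ _
      (fun x => Cmult (Cmult m E) (cexp (Cmult m (RtoC (x - -1)))))
      (fun x => Cmult m (csh m x))
      (fun x => Cmult (Cmult (Copp m) E) (cexp (Cmult (Copp m) (RtoC (x - 1)))))
      (fun x => Cmult (Cmult m m) (Cmult E (cexp (Cmult m (RtoC (x - -1))))))
      (fun x => Cmult (Cmult m m) (cch m x))
      (fun x => Cmult (Cmult m m) (Cmult E (cexp (Cmult (Copp m) (RtoC (x - 1)))))) M);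
      fold E.
    1-6: intros x; derive_C; unfold E; ring.
    + replace (-1 - -1) with 0 by ring. replace (Cmult m (RtoC 0)) with (RtoC 0) by ring.
      rewrite cexp_0. replace (-1) with (- (1)) by ring. rewrite cch_opp. unfold E. ring.
    + replace (1 - 1) with 0 by ring. replace (Cmult (Copp m) (RtoC 0)) with (RtoC 0) by ring.
      rewrite cexp_0. unfold E. ring.
    + rewrite cch_0. ring.
    + rewrite cch_0. ring.
    + reflexivity.
    + intros; ring.
    + reflexivity.
    + exact HM.
    + replace (-1 - -1) with 0 by ring. replace (Cmult m (RtoC 0)) with (RtoC 0) by ring.
      rewrite cexp_0, csh_0. replace (-1) with (- (1)) by ring. rewrite csh_opp.
      transitivity (Cminus (Cmult (RtoC Rp) (Cmult m m)) (Cplus (Cmult m (Cplus E (csh m 1))) (Cmult (RtoC Rp) (Cmult m m)))); [ring | rewrite HE; ring].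
    + replace (1 - 1) with 0 by ring. replace (Cmult (Copp m) (RtoC 0)) with (RtoC 0) by ring.
      rewrite cexp_0, csh_0.
      transitivity (Cminus (Cmult (RtoC Rp) (Cmult m m)) (Cplus (Cmult m (Cplus E (csh m 1))) (Cmult (RtoC Rp) (Cmult m m)))); [ring | rewrite HE; ring].
  - exists 1. intros H0. pose proof (mode_1 m) as K. rewrite H0, Cmult_0_r in K.
    symmetry in K. revert K. apply Cmult_neq_0; intros K; apply (cexp_neq_1 m Hm);
    transitivity (Cplus (Cminus (cexp m) (RtoC 1)) (RtoC 1)); try ring; rewrite K; ring.
Qed.

Lemma is_derive_comp_opp (f : R -> C) (x : R) (l : C) :
  is_derive f (- x) l -> is_derive (fun t => f (- t)) x (Copp l).
Proof.
  intros H.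
  pose proof (is_derive_comp (V := C_R_NormedModule) f Ropp x l (-1) H) as K.
  replace (Copp l) with (scal (-1) l : C_R_NormedModule).
  - apply K. auto_derive; auto; ring.
  - destruct l as [u v]. change ((-1 * u, -1 * v) = (- u, - v)). f_equal; ring.
Qed.

Lemma filterlim_C_opp {T} (F : (T -> Prop) -> Prop) {FF : Filter F} (f : T -> C) (l : C) :
  filterlim f F (locally l) -> filterlim (fun t => Copp (f t)) F (locally (Copp l)).
Proof.
  intros H. eapply filterlim_comp; [exact H | exact (filterlim_opp (V := C_R_NormedModule) l)].
Qed.

(** One computation serves two purposes: [ka = 0] is the eigenvalue problem and [ka = 1] the Jordan
    chain over [mode m]. The numbers [b = h'(0)] and [c = h''(0)] carry the odd and the even part of
    [h]. *)
Lemma solves_forced_by_mode (Rp : R) (m ka : C) (h : R -> C) :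
  0 < Re m -> solves Rp (Cmult m m) (fun x => Cmult ka (mode m x)) h ->
  exists b c : C, Cmult b (Cminus (cexp m) (RtoC 1)) = RtoC 0 /\
    Cplus (Cplus (Cmult (Cmult (RtoC 2) (Cminus c ka)) (Cminus (cexp m) (RtoC 1)))
       (Cmult ka (Cplus (Cmult m (cexp m)) (Cminus (cexp m) (RtoC 1)))))
       (Cmult (Cmult (RtoC 2) (Cmult (RtoC Rp) m)) c) = RtoC 0 /\
    (ka = RtoC 0 -> b = RtoC 0 -> forall x, h x = Cmult (Cdiv c (Cmult m m)) (mode m x)).
Proof.
  intros Hre (h1 & h2 & Hc & H0 & (M & HM) & HD & HO & dLm & dRm & dLp & dRp & L1 & L2 & L3 & L4 & J1 & J2).
  pose proof (Re_pos_neq_0 m Hre) as Hm. pose proof two_neq_0 as H2.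
  set (b := h1 0) in *. set (c := h2 0) in *.
  assert (HO' : forall x, -1 < x < 1 ->
     Cminus (Cminus (h2 x) c) (Cmult (Cmult m m) (h x)) = Cmult ka (Cminus (cch m x) (RtoC 1))).
  { intros x Hx. specialize (HO x ltac:(lra) ltac:(lra)).
    unfold chi11, mode in HO. destruct (Rlt_dec (-1) x); [ | lra]. destruct (Rlt_dec x 1); [ | lra].
    rewrite pw_mid in HO by lra. rewrite <- HO. ring. }
  assert (HO'' : forall x, 1 < x ->
     Cminus (h2 x) (Cmult (Cmult m m) (h x)) =
       Cmult ka (Cmult (Cminus (cch m 1) (RtoC 1)) (cexp (Cmult (Copp m) (RtoC (x - 1)))))).
  { intros x Hx. specialize (HO x ltac:(lra) ltac:(lra)).
    unfold chi11, mode in HO. destruct (Rlt_dec (-1) x); [ | lra]. destruct (Rlt_dec x 1); [lra | ].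
    rewrite pw_right in HO by lra. rewrite <- HO. ring. }
  assert (HO''' : forall x, 1 < x ->
     Cminus (h2 (- x)) (Cmult (Cmult m m) (h (- x))) =
       Cmult ka (Cmult (Cminus (cch m 1) (RtoC 1)) (cexp (Cmult (Copp m) (RtoC (x - 1)))))).
  { intros x Hx. specialize (HO (- x) ltac:(lra) ltac:(lra)).
    rewrite mode_opp in HO.
    unfold chi11, mode in HO. destruct (Rlt_dec (-1) (- x)); [lra | ].
    rewrite pw_right in HO by lra. rewrite <- HO. ring. }
  destruct (right_side m ka b c dLp dRp h h1 h2 M) as (A1 & A2 & A3 & A4); auto.
  { intros x Hx. destruct (HD x) as [D1 D2]; try lra. auto. }
  { intros x Hx. destruct (HD x) as [D1 D2]; try lra. auto. }
  (* The reflected function has derivative [- h1 (- x)], so [b] changes sign while [c] does not, and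
     the traces at [-1] appear exchanged and negated. *)
  destruct (right_side m ka (Copp b) c (Copp dRm) (Copp dLm)
     (fun x => h (- x)) (fun x => Copp (h1 (- x))) (fun x => h2 (- x)) M) as (B1 & B2 & B3 & B4); auto.
  { intros x Hx. destruct (HD (- x)) as [D1 D2]; try lra. split; [ | split].
    - now apply is_derive_comp_opp.
    - apply (is_derive_C_eq _ _ (Copp (Copp (h2 (- x))))); [ | ring].
      apply (is_derive_C_opp (fun x => h1 (- x))). now apply is_derive_comp_opp.
    - rewrite HO' by lra. now rewrite cch_opp. }
  { intros x Hx. destruct (HD (- x)) as [D1 D2]; try lra. split; [ | split].
    - now apply is_derive_comp_opp.
    - apply (is_derive_C_eq _ _ (Copp (Copp (h2 (- x))))); [ | ring].
      apply (is_derive_C_opp (fun x => h1 (- x))). now apply is_derive_comp_opp.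
    - auto. }
  { apply (continuous_comp Ropp h); [ | apply Hc].
    apply (continuous_opp (V := R_NormedModule) (fun x => x)), continuous_id. }
  { now rewrite Ropp_0. }
  { now rewrite Ropp_0. }
  { apply filterlim_C_opp; [apply (at_left_proper_filter 1) | ].
    eapply filterlim_comp; [apply filterlim_Ropp_left | exact L2]. }
  { apply filterlim_C_opp; [apply (at_right_proper_filter 1) | ].
    eapply filterlim_comp; [apply filterlim_Ropp_right | exact L1]. }
  exists b, c.
  pose proof (cch_plus_csh m) as Ecs.
  (* The sum of the two jump conditions contains only [c], their difference only [b]. *)
  assert (S1 : Cplus (Cminus dRp dLp) (Cminus dRm dLm) = Cmult (RtoC 2) (Cmult (RtoC Rp) c))
    by (rewrite J1, J2; ring).
  assert (S2 : Cminus (Cminus dRm dLm) (Cminus dRp dLp) = Cmult (RtoC 2) b)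
    by (rewrite J1, J2; ring).
  replace (Cminus dRm dLm) with (Cminus (Copp dLm) (Copp dRm)) in S1, S2 by ring.
  rewrite A3, A4, B3, B4 in S1, S2. unfold inner_sol, inner_sol1 in S1, S2.
  split; [ | split].
  - rewrite <- Ecs.
    transitivity (Cdiv (Cminus (Cmult (RtoC 2) (Cmult b (Cplus (cch m 1) (csh m 1)))) (Cmult (RtoC 2) b)) (RtoC 2)); [field; auto | ].
    rewrite <- S2. field. auto.
  - rewrite <- Ecs.
    replace (Cmult (Cmult (RtoC 2) (Cmult (RtoC Rp) m)) c) with
      (Cmult m (Cmult (RtoC 2) (Cmult (RtoC Rp) c))) by ring.
    rewrite <- S1. field. auto.
  - intros Hka Hb x. rewrite Hka, Hb in *.
    unfold mode.
    destruct (Rlt_le_dec x (-1)) as [L | L]; [ | destruct (Rlt_le_dec 1 x) as [L' | L']].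
    + rewrite pw_left by lra. rewrite <- (Ropp_involutive x), (B2 (- x)) by lra.
      rewrite Ropp_involutive.
      replace (Cmult (Copp m) (RtoC (- x - 1))) with (Cmult m (RtoC (x - -1)))
        by (rewrite !RtoC_minus, !RtoC_opp; ring).
      unfold inner_sol. field. auto.
    + rewrite pw_right, A2 by lra. unfold inner_sol. field. auto.
    + rewrite pw_mid by lra.
      destruct (Req_dec x (-1)) as [-> | N].
      * rewrite <- (Ropp_involutive (-1)), (B1 (- -1)), cch_opp by lra. unfold inner_sol. field. auto.
      * rewrite A1 by lra. unfold inner_sol. field. auto.
Qed.

(** * Location of the characteristic roots *)

Lemma nondecreasing_of_derive (f f' : R -> R) (a b : R) :
  a <= b -> (forall t, a <= t <= b -> is_derive f t (f' t)) ->
  (forall t, a <= t <= b -> 0 <= f' t) -> f a <= f b.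
Proof.
  intros [L | ->] D P; [ | apply Rle_refl].
  destruct (MVT_cor2 f f' a b L) as (c & E & Hc).
  - intros t Ht. apply is_derive_Reals. auto.
  - pose proof (P c ltac:(lra)). nra.
Qed.

Lemma increasing_of_derive (f f' : R -> R) (a b : R) :
  a < b -> (forall t, a <= t <= b -> is_derive f t (f' t)) ->
  (forall t, a <= t <= b -> 0 < f' t) -> f a < f b.
Proof.
  intros L D P.
  destruct (MVT_cor2 f f' a b L) as (c & E & Hc).
  - intros t Ht. apply is_derive_Reals. auto.
  - pose proof (P c ltac:(lra)). nra.
Qed.

Lemma exp_ge_quadratic (x : R) : 0 <= x -> 1 + x + x * x / 2 <= exp x.
Proof.
  intros Hx.
  assert (H : exp 0 - 1 - 0 - 0 * 0 / 2 <= exp x - 1 - x - x * x / 2).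
  { apply (nondecreasing_of_derive (fun t => exp t - 1 - t - t * t / 2) (fun t => exp t - 1 - t) 0 x Hx).
    - intros t Ht. auto_derive; auto. field.
    - intros t Ht. pose proof (exp_ineq1_le t). lra. }
  rewrite exp_0 in H. lra.
Qed.

(** The lower bound places [9 / 2] below [3 PI / 2]; the upper bound places [37 / 10], and hence
    [a0], above [PI]. *)
Lemma PI_bounds : 3 < PI < 18 / 5.
Proof.
  split.
  - pose proof PI2_3_2. lra.
  (* The partial sum [1 - 1/3 + 1/5] of the Leibniz series gives [PI <= 52 / 15]. *)
  - pose proof (proj2 (PI_ineq 1)) as H. unfold tg_alt, PI_tg in H. simpl in H. lra.
Qed.

(** The interval lies in the third quadrant, and [1 + a0 + a0^2 / 2 > 12] there. *)
Lemma a0_facts (a0 : R) :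
  39 / 10 < a0 < 4 -> cos a0 - sin a0 = exp (- a0) ->
  cos a0 < 0 /\ sin a0 < 0 /\ exp (- a0) <= 1 / 12.
Proof.
  intros Ha Heq. pose proof PI_bounds as HP.
  split; [ | split].
  - apply cos_lt_0; lra.
  - apply sin_lt_0; lra.
  - rewrite exp_Ropp.
    pose proof (exp_ge_quadratic a0 ltac:(lra)).
    replace (1 / 12) with (/ 12) by lra. apply Rinv_le_contravar; nra.
Qed.

Definition Kfun (y : R) : R := - y * cos y / sin y + ln (- y / sin y).

Definition Kder (y : R) : R :=
  (y * y - 2 * y * sin y * cos y + sin y * sin y) / (y * (sin y * sin y)).

Lemma Kfun_arg_pos (y : R) : 0 < y -> sin y < 0 -> 0 < - y / sin y.
Proof.
  intros Hy Hs. replace (- y / sin y) with (y * / (- sin y)) by (field; lra).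
  apply Rmult_lt_0_compat; [lra | apply Rinv_0_lt_compat; lra].
Qed.

Lemma is_derive_Kfun (y : R) : 0 < y -> sin y < 0 -> is_derive Kfun y (Kder y).
Proof.
  intros Hy Hs. unfold Kfun, Kder. pose proof (Kfun_arg_pos y Hy Hs).
  auto_derive.
  - repeat split; auto; lra.
  - pose proof (sin2_cos2 y) as E. unfold Rsqr in E.
    set (s := sin y) in *. set (c := cos y) in *.
    transitivity ((y * y * (s * s + c * c) - 2 * y * s * c + s * s) / (y * (s * s))).
    + field. lra.
    + rewrite E. f_equal. ring.
Qed.

(** With [s = sin y] and [c = cos y] the numerator is the sum of squares [(y - s c)^2 + s^4]. *)
Lemma Kder_pos (y : R) : 0 < y -> sin y < 0 -> 0 < Kder y.
Proof.
  intros Hy Hs. unfold Kder. pose proof (sin2_cos2 y) as E. unfold Rsqr in E.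
  set (s := sin y) in *. set (c := cos y) in *.
  assert (0 < s * s) by nra.
  apply Rdiv_lt_0_compat; [ | nra].
  replace (y * y - 2 * y * s * c + s * s)
    with ((y - s * c) * (y - s * c) + s * s * (1 - c * c)) by ring.
  replace (1 - c * c) with (s * s) by lra.
  apply Rplus_le_lt_0_compat; [apply Rle_0_sqr | now apply Rmult_lt_0_compat].
Qed.

Lemma Kfun_increasing (y z : R) : PI < y -> y < z -> z < 2 * PI -> Kfun y < Kfun z.
Proof.
  intros H1 H2 H3. pose proof PI_bounds.
  apply (increasing_of_derive Kfun Kder); auto; intros t Ht;
  [apply is_derive_Kfun | apply Kder_pos]; try lra; apply sin_lt_0; lra.
Qed.

(* Eliminating [x] from the real and imaginary parts of the characteristic
   equation at [mu = x + i y] separates the variables [y] and [r]. *)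
Lemma Kfun_characteristic (r x y : R) :
  0 < r -> 0 < y -> sin y < 0 ->
  exp x * cos y = 1 - r * x -> exp x * sin y = - r * y ->
  Kfun y = / r - ln r.
Proof.
  intros Hr Hy Hs Ec Es. pose proof (Kfun_arg_pos y Hy Hs) as Hp.
  assert (Ex : exp x = r * (- y / sin y)).
  { apply (Rmult_eq_reg_r (sin y)); [ | lra]. rewrite Es. field. lra. }
  assert (Lx : x = ln r + ln (- y / sin y)).
  { rewrite <- ln_mult by assumption. rewrite <- Ex. symmetry. apply ln_exp. }
  unfold Kfun. apply (Rmult_eq_reg_l r); [ | lra].
  replace (r * (- y * cos y / sin y + ln (- y / sin y))) with
    (r * (- y / sin y) * cos y + r * (ln r + ln (- y / sin y)) - r * ln r) by (field; lra).
  rewrite <- Lx, <- Ex, Ec. field. lra.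
Qed.

Definition char_eq (r x y : R) : Prop :=
  exp x * cos y = 1 - r * x /\ exp x * sin y = - r * y.

(** The squared moduli of the two sides of [e^m = 1 - r m]. *)
Lemma char_eq_norm (r x y : R) : char_eq r x y ->
  exp x * exp x = (1 - r * x) * (1 - r * x) + r * y * (r * y).
Proof.
  intros [E1 E2]. pose proof (sin2_cos2 y) as E. unfold Rsqr in E.
  replace (exp x * exp x) with (exp x * exp x * (sin y * sin y + cos y * cos y))
    by (rewrite E; ring).
  replace (exp x * exp x * (sin y * sin y + cos y * cos y)) with
    (exp x * sin y * (exp x * sin y) + exp x * cos y * (exp x * cos y)) by ring.
  rewrite E1, E2. ring.
Qed.

(** The condition [y^2 < x^2] expresses [Re (m^2) > 0] for [m = x + i y]. *)
Lemma no_char_root_small (r x y : R) :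
  -1 <= r <= 1 -> 0 < x -> y * y < x * x -> ~ char_eq r x y.
Proof.
  intros Hr Hx Hy H. apply char_eq_norm in H.
  pose proof (exp_ge_quadratic x ltac:(lra)) as Q.
  assert ((1 + x + x * x / 2) * (1 + x + x * x / 2) <= exp x * exp x)
    by (apply Rmult_le_compat; nra).
  assert (r * r <= 1) by nra.
  assert ((1 - r * x) * (1 - r * x) <= (1 + x) * (1 + x)) by nra.
  assert (r * y * (r * y) <= x * x) by nra.
  (* The square of [1 + x + x^2 / 2] is [1 + 2 x + 2 x^2 + x^3 + x^4 / 4]; the cubic term makes the
     comparison strict. *)
  assert (0 < x * x * x) by (apply Rmult_lt_0_compat; nra).
  nra.
Qed.

Definition R0_of (a : R) : R := (1 - exp a * cos a) / a.
Lemma exp_a0_cancel (a0 : R) (Heq : cos a0 - sin a0 = exp (- a0)) : exp a0 * (cos a0 - sin a0) = 1.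
Proof. rewrite Heq, <- exp_plus, Rplus_opp_r. apply exp_0. Qed.

(** At [m = a0 (1 + i)], whose square is purely imaginary, the real part of the equation defines
    [R0], and the equation for [a0] makes the imaginary part consistent with it. *)
Lemma char_eq_R0 (a0 : R) (Ha0 : 39 / 10 < a0 < 4) (Heq : cos a0 - sin a0 = exp (- a0)) :
  char_eq (R0_of a0) a0 a0.
Proof.
  pose proof (exp_a0_cancel a0 Heq) as E. unfold char_eq, R0_of.
  split; [field; lra | ].
  replace (- ((1 - exp a0 * cos a0) / a0) * a0) with (exp a0 * cos a0 - 1) by (field; lra). lra.
Qed.

Lemma R0_pos (a0 : R) (Ha0 : 39 / 10 < a0 < 4) (Heq : cos a0 - sin a0 = exp (- a0)) : 0 < R0_of a0.
Proof.
  destruct (a0_facts a0 Ha0 Heq) as (Hc & Hs & He).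
  unfold R0_of. apply Rdiv_lt_0_compat; [ | lra]. pose proof (exp_pos a0). nra.
Qed.

Lemma Kfun_a0 (a0 : R) (Ha0 : 39 / 10 < a0 < 4) (Heq : cos a0 - sin a0 = exp (- a0)) :
  Kfun a0 = / R0_of a0 - ln (R0_of a0).
Proof.
  destruct (a0_facts a0 Ha0 Heq) as (Hc & Hs & He).
  destruct (char_eq_R0 a0 Ha0 Heq) as [E1 E2].
  apply (Kfun_characteristic (R0_of a0) a0 a0); try apply (R0_pos a0 Ha0 Heq); auto; lra.
Qed.

(** As [|1 - r m|] is of linear size in [x], it cannot keep up with [e^x]. The threshold [9 / 2] is
    chosen to keep [y < x] below [3 PI / 2]. *)
Lemma char_root_bound (a0 : R) (Ha0 : 39 / 10 < a0 < 4) (Heq : cos a0 - sin a0 = exp (- a0))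
  (r x y : R) :
  0 < r <= R0_of a0 -> 0 < x -> y * y < x * x -> char_eq r x y -> x < 9 / 2.
Proof.
  intros Hr Hx Hy H. apply char_eq_norm in H.
  destruct (a0_facts a0 Ha0 Heq) as (Hc & Hs & He).
  destruct (Rlt_le_dec x (9 / 2)) as [L | L]; [exact L | exfalso].
  destruct (char_eq_R0 a0 Ha0 Heq) as [_ E2].
  set (u := x - a0). assert (Hu : 1 / 2 <= u) by (unfold u; lra).
  pose proof (exp_ineq1_le u) as Eu.
  pose proof (sin2_cos2 a0) as T. unfold Rsqr in T.
  set (s := - sin a0) in *. set (e := exp (- a0)) in *.
  assert (Hep : 0 < e) by apply exp_pos.
  assert (Ee : exp a0 * e = 1) by (unfold e; rewrite <- exp_plus, Rplus_opp_r; apply exp_0).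
  assert (Ex : e * exp x = exp u) by (unfold e, u; rewrite <- exp_plus; f_equal; ring).
  (* Scaling by [e^(-a0)] replaces [R0] by [s = - sin a0], so no numerical value of [R0] is
     needed. *)
  assert (Es : e * (R0_of a0 * a0) = s).
  { transitivity (e * - (exp a0 * sin a0)); [rewrite E2; ring | ].
    transitivity (exp a0 * e * s); [unfold s; ring | rewrite Ee; ring]. }
  (* From [cos a0 = e - s] one gets [2 s^2 = 1 + 2 e s - e^2], with [s <= 1] and [e <= 1 / 12]. *)
  assert (Hss : 2 * (s * s) <= 7 / 6).
  { assert (Hs1 : s <= 1) by (pose proof (SIN_bound a0); unfold s; lra).
    assert (cos a0 = e - s) by (unfold s; lra).
    rewrite H0 in T. unfold s in *. nra. }
  assert (B : exp x * exp x <= 1 + 2 * (R0_of a0 * x * (R0_of a0 * x))).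
  { rewrite H.
    assert (r * r <= R0_of a0 * R0_of a0) by nra.
    assert (0 <= x * x) by nra.
    assert (r * r * (y * y) <= r * r * (x * x)) by (apply Rmult_le_compat_l; nra).
    assert (r * r * (x * x) <= R0_of a0 * R0_of a0 * (x * x)) by (apply Rmult_le_compat_r; nra).
    assert (0 < r * x) by nra. nra. }
  assert (B2 : exp u * exp u * (a0 * a0) <= e * e * (a0 * a0) + 2 * (s * s) * (x * x)).
  { rewrite <- Ex, <- Es.
    replace (e * exp x * (e * exp x) * (a0 * a0))
      with (e * e * (a0 * a0) * (exp x * exp x)) by ring.
    apply Rle_trans with (e * e * (a0 * a0) * (1 + 2 * (R0_of a0 * x * (R0_of a0 * x)))).
    - apply Rmult_le_compat_l; [ | exact B]. nra.
    - right. ring. }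
  assert ((1 + u) * (1 + u) <= exp u * exp u) by (apply Rmult_le_compat; lra).
  assert (e * e <= 1 / 144) by nra.
  assert (2 * (s * s) * (x * x) <= 7 / 6 * (x * x)) by (apply Rmult_le_compat_r; nra).
  assert (x = a0 + u) by (unfold u; ring).
  assert (B3 : (1 + u) * (1 + u) * (a0 * a0) <= 1 / 144 * (a0 * a0) + 7 / 6 * ((a0 + u) * (a0 + u))).
  { rewrite <- H3. nra. }
  (* Since [7/6 * 16/25 < 3/4], bound [B3] would give [w^2 / 4 < a0^2 / 144], against
     [w >= 3/2 a0]. *)
  set (w := (1 + u) * a0) in *.
  assert (Hw : a0 + u <= 4 / 5 * w) by (unfold w; nra).
  assert (Hw' : 3 / 2 * a0 <= w) by (unfold w; nra).
  assert ((a0 + u) * (a0 + u) <= 4 / 5 * w * (4 / 5 * w)) by (apply Rmult_le_compat; lra).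
  assert (3 / 2 * a0 * (3 / 2 * a0) <= w * w) by (apply Rmult_le_compat; lra).
  replace ((1 + u) * (1 + u) * (a0 * a0)) with (w * w) in B3 by (unfold w; ring).
  assert (0 < a0 * a0) by nra.
  lra.
Qed.

Lemma no_char_root (a0 : R) (Ha0 : 39 / 10 < a0 < 4) (Heq : cos a0 - sin a0 = exp (- a0))
  (r x y : R) :
  -1 <= r <= R0_of a0 -> 0 < x -> y * y < x * x -> ~ char_eq r x y.
Proof.
  intros Hr Hx.
  assert (Main : forall y, 0 <= y -> y * y < x * x -> ~ char_eq r x y).
  { clear y. intros y Hy Hyx H.
    destruct (Rle_lt_dec r 1) as [L | L].
    { apply (no_char_root_small r x y); auto; lra. }
    pose proof (char_root_bound a0 Ha0 Heq r x y ltac:(lra) Hx Hyx H) as Hx'.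
    destruct (a0_facts a0 Ha0 Heq) as (Hc & Hs & He).
    pose proof PI_bounds as HP. pose proof (exp_pos x) as Hep.
    assert (Hlt : y < x) by nra.
    destruct H as [E1 E2].
    (* On the real axis [e^x = 1 - r x < 1] is impossible for [x > 0]. *)
    assert (Hy0 : 0 < y).
    { destruct Hy as [Hy | <-]; [exact Hy | exfalso].
      rewrite cos_0 in E1. pose proof (exp_ineq1 x). nra. }
    assert (Hsy : sin y < 0) by nra.
    assert (HyPI : PI < y).
    { destruct (Rle_lt_dec y PI) as [L' | L']; [ | exact L'].
      pose proof (sin_ge_0 y ltac:(lra) L'). lra. }
    (* The function [1 / r - ln r] decreases, so [r <= R0] forces [K y >= K a0]. *)
    assert (Hya : a0 <= y).
    { destruct (Rle_lt_dec a0 y) as [L' | L']; [exact L' | exfalso].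
      pose proof (Kfun_increasing y a0 HyPI L' ltac:(lra)) as I.
      rewrite (Kfun_a0 a0 Ha0 Heq), (Kfun_characteristic r x y) in I; auto; try lra.
      assert (/ R0_of a0 <= / r) by (apply Rinv_le_contravar; lra).
      assert (ln r <= ln (R0_of a0)) by (destruct (proj2 Hr) as [Hl | ->];
        [left; apply ln_increasing; lra | right; reflexivity]).
      lra. }
    assert (cos a0 <= cos y).
    { destruct Hya as [Hya | <-]; [ | lra]. left. apply cos_increasing_1; lra. }
    assert (sin y <= sin a0).
    { destruct Hya as [Hya | <-]; [ | lra]. left. apply sin_decreasing_1; lra. }
    (* Subtracting the two equations gives [e^x (cos y - sin y) = 1 - r (x - y) < 1], and
       [cos - sin] increases on [(PI, 3 PI / 2)]. Hence [e^(x - a0) < 1], contrary to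
       [a0 <= y < x]. *)
    assert (exp x * (cos a0 - sin a0) < 1) by nra.
    rewrite Heq, <- exp_plus in H1.
    pose proof (exp_ineq1_le (x + - a0)). lra. }
  intros Hyx [E1 E2].
  destruct (Rle_lt_dec 0 y) as [L | L].
  - apply (Main y L Hyx). split; assumption.
  - apply (Main (- y)); [lra | nra | ]. split; [rewrite cos_neg | rewrite sin_neg]; lra.
Qed.

(** * From eigenvalues to characteristic roots *)

(** The principal root, with real part [sqrt ((|lam| + Re lam) / 2)]. *)
Lemma sqrt_right_half_plane (lam : C) : 0 < Re lam ->
  exists m : C, 0 < Re m /\ Cmult m m = lam.
Proof.
  intros H. destruct lam as [p q]. unfold Re in *; simpl in *.
  pose proof (Cmod2_alt (p, q)) as E. unfold Re, Im in E; simpl in E.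
  set (rho := Cmod (p, q)) in *.
  pose proof (Cmod_ge_0 (p, q)) as Hrho. fold rho in Hrho.
  set (a := sqrt ((rho + p) / 2)).
  assert (Ha : 0 < a) by (apply sqrt_lt_R0; lra).
  assert (Haa : a * a = (rho + p) / 2) by (apply sqrt_sqrt; lra).
  exists (a, q / (2 * a)). simpl. split; [exact Ha | ].
  unfold Cmult; simpl. f_equal; [ | field; lra].
  apply (Rmult_eq_reg_r (4 * (a * a))); [ | nra].
  transitivity (4 * (a * a) * (a * a) - q * q); [field; lra | ].
  rewrite Haa. nra.
Qed.

Lemma char_eq_iff (Rp : R) (m : C) :
  Cplus (Cminus (cexp m) (RtoC 1)) (Cmult (RtoC Rp) m) = RtoC 0 <-> char_eq Rp (Re m) (Im m).
Proof.
  destruct m as [x y]. unfold char_eq, cexp, Re, Im; simpl.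
  split.
  - intros H. injection H as H1 H2. lra.
  - intros [H1 H2]. unfold Cplus, Cminus, Cmult, Copp, RtoC; simpl. f_equal; lra.
Qed.

(** As [e^m <> 1], the odd coefficient [b] vanishes; then [c = 0] would make the eigenfunction zero,
    so the factor multiplying [c] must vanish. *)
Lemma eigenvalue_char (Rp : R) (m : C) :
  0 < Re m -> is_eigenvalue Rp (Cmult m m) ->
  Cplus (Cminus (cexp m) (RtoC 1)) (Cmult (RtoC Rp) m) = RtoC 0.
Proof.
  intros Hm (g & Hg & x & Hx). pose proof (Re_pos_neq_0 m Hm) as Hm0.
  destruct (solves_forced_by_mode Rp m (RtoC 0) g Hm) as (b & c & Hb & Hc & Hform).
  { replace (fun x : R => Cmult (RtoC 0) (mode m x)) with (fun _ : R => RtoC 0); [exact Hg | ].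
    apply functional_extensionality. intros t. ring. }
  assert (b = RtoC 0).
  { apply NNPP. intros Nb. revert Hb. apply Cmult_neq_0; [exact Nb | ].
    intros K. apply (cexp_neq_1 m Hm).
    transitivity (Cplus (Cminus (cexp m) (RtoC 1)) (RtoC 1)); [ring | rewrite K; ring]. }
  specialize (Hform eq_refl H).
  assert (Nc : c <> RtoC 0).
  { intros ->. apply Hx. rewrite Hform. field. exact Hm0. }
  apply NNPP. intros N.
  assert (K : Cmult (Cmult (RtoC 2) c) (Cplus (Cminus (cexp m) (RtoC 1)) (Cmult (RtoC Rp) m)) = RtoC 0).
  { rewrite <- Hc. ring. }
  revert K. apply Cmult_neq_0; [apply Cmult_neq_0; auto using two_neq_0 | exact N].
Qed.

Lemma stable_below_R0 (a0 : R) (Ha0 : 39 / 10 < a0 < 4) (Heq : cos a0 - sin a0 = exp (- a0))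
  (Rp : R) (lam : C) : -1 <= Rp <= R0_of a0 -> is_eigenvalue Rp lam -> Re lam <= 0.
Proof.
  intros HR He. apply Rnot_lt_le. intros Hl.
  destruct (sqrt_right_half_plane lam Hl) as (m & Hm & <-).
  apply (no_char_root a0 Ha0 Heq Rp (Re m) (Im m)); auto.
  - unfold Re, Im in *. simpl in Hl. lra.
  - apply char_eq_iff, eigenvalue_char; auto.
Qed.

(** * The real branch *)

(* The unstable real eigenvalue at [r = - s] is the square of the positive root
   of [e^m = 1 + s m]; for [s <= 1] only the root [0] is left. *)
Definition real_root (s m : R) : Prop :=
  0 <= m /\ exp m = 1 + Rmax 1 s * m /\ (1 < s -> 0 < m) /\ (s <= 1 -> m = 0).

Lemma real_root_exists (s : R) : exists m, real_root s m.
Proof.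
  destruct (Rle_lt_dec s 1) as [L | L].
  { exists 0. unfold real_root. rewrite exp_0. repeat split; lra. }
  assert (Hln : ln s < s - 1).
  { assert (1 + ln s < exp (ln s)).
    { apply exp_ineq1. intros E. rewrite <- ln_1 in E. apply ln_inv in E; lra. }
    rewrite exp_ln in H; lra. }
  assert (Hln0 : 0 < ln s) by (rewrite <- ln_1; apply ln_increasing; lra).
  assert (Hln' : 1 - / s < ln s).
  { assert (1 + - ln s < exp (- ln s)) by (apply exp_ineq1; lra).
    rewrite exp_Ropp, exp_ln in H; lra. }
  (* The point [ln s > 0] is the minimiser, where the value [s - 1 - s ln s] is negative; starting
     there excludes the trivial root [0]. At [2 s] the quadratic bound for [exp] gives a positive
     value. *)
  destruct (IVT (fun m => exp m - 1 - s * m) (ln s) (2 * s)) as (m & Hm & Em).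
  - intros m. apply continuity_pt_filterlim.
    apply (ex_derive_continuous (fun m => exp m - 1 - s * m)). auto_derive. auto.
  - lra.
  - rewrite exp_ln by lra.
    apply (Rmult_lt_compat_l s) in Hln'; [ | lra].
    replace (s * (1 - / s)) with (s - 1) in Hln' by (field; lra). lra.
  - pose proof (exp_ge_quadratic (2 * s) ltac:(lra)). nra.
  - exists m. unfold real_root. rewrite Rmax_right by lra. repeat split; lra.
Qed.

(** At the root [m] the function [e^m - 1 - S m] has slope at least [m / 2]. This degenerates at
    [m = 0], but the second-order term of [e^(n - m)] adds [(n - m)^2 / 2], and together they give
    [n (n - m) / 2 <= n (T - S)], where [n > 0] cancels. *)
Lemma real_root_Lipschitz (s t m n : R) :
  real_root s m -> real_root t n -> m < n -> n - m <= 2 * (Rmax 1 t - Rmax 1 s).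
Proof.
  intros (Hm & Em & Hm1 & _) (Hn & En & _ & _) L.
  assert (D : m / 2 <= 1 + Rmax 1 s * m - Rmax 1 s).
  { destruct (Rle_lt_dec m 0) as [Z | P].
    - assert (m = 0) by lra. subst m.
      destruct (Rle_lt_dec s 1); [rewrite Rmax_left by lra; lra | exfalso; specialize (Hm1 r); lra].
    (* Inserting [e^m = 1 + S m] and dividing by [m] turns this into the slope bound. *)
    - assert (A : m * m / 2 <= m * exp m - exp m + 1).
      { assert (H : 0 * exp 0 - exp 0 + 1 - 0 * 0 / 2 <= m * exp m - exp m + 1 - m * m / 2).
        { apply (nondecreasing_of_derive (fun t => t * exp t - exp t + 1 - t * t / 2)
            (fun t => t * (exp t - 1)) 0 m Hm).
          - intros x Hx. auto_derive; auto. field.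
          - intros x Hx. pose proof (exp_ineq1_le x). nra. }
        rewrite exp_0 in H. lra. }
      rewrite Em in A.
      apply (Rmult_le_reg_l m); [exact P | ]. lra. }
  set (S := Rmax 1 s) in *. set (T := Rmax 1 t) in *.
  assert (HS : 1 <= S) by apply Rmax_l.
  assert (Q : (1 + S * m) * (1 + (n - m) + (n - m) * (n - m) / 2) <= 1 + T * n).
  { rewrite <- En, <- Em. replace (exp n) with (exp m * exp (n - m))
    by (rewrite <- exp_plus; f_equal; ring).
    apply Rmult_le_compat_l; [left; apply exp_pos | apply exp_ge_quadratic; lra]. }
  assert (F : n * ((n - m) / 2) <= n * (T - S)).
  { apply Rle_trans with ((n - m) * (m / 2) + (n - m) * (n - m) / 2); [right; field | ].
    assert ((n - m) * (m / 2) <= (n - m) * (1 + S * m - S)) by (apply Rmult_le_compat_l; lra).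
    assert (0 <= S * m * ((n - m) * (n - m) / 2)).
    { apply Rmult_le_pos; [apply Rmult_le_pos; lra | ]. pose proof (Rle_0_sqr (n - m)) as Z. unfold Rsqr in Z. lra. }
    nra. }
  apply Rmult_le_reg_l in F; lra.
Qed.

Lemma Rmax_1_Lipschitz (s t : R) : Rabs (Rmax 1 t - Rmax 1 s) <= Rabs (t - s).
Proof.
  unfold Rmax. destruct (Rle_dec 1 t), (Rle_dec 1 s); split_Rabs; lra.
Qed.

Lemma continuous_real_root (mu : R -> R) (s : R) :
  (forall s, real_root s (mu s)) -> continuous mu s.
Proof.
  intros H.
  assert (Lip : forall t, Rabs (mu t - mu s) <= 2 * Rabs (t - s)).
  { intros t. pose proof (Rmax_1_Lipschitz s t) as K.
    destruct (Rtotal_order (mu s) (mu t)) as [L | [E | L]].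
    - pose proof (real_root_Lipschitz _ _ _ _ (H s) (H t) L).
      pose proof (Rle_abs (Rmax 1 t - Rmax 1 s)). rewrite Rabs_pos_eq; lra.
    - rewrite E, Rminus_diag, Rabs_R0. pose proof (Rabs_pos (t - s)). lra.
    - pose proof (real_root_Lipschitz _ _ _ _ (H t) (H s) L).
      pose proof (Rle_abs (- (Rmax 1 t - Rmax 1 s))) as A. rewrite Rabs_Ropp in A.
      rewrite Rabs_left; lra. }
  apply filterlim_locally. intros eps.
  assert (He : 0 < eps / 2) by (destruct eps; simpl; lra).
  exists (mkposreal _ He). intros t Ht. specialize (Lip t).
  change (Rabs (t - s) < eps / 2) in Ht. change (Rabs (mu t - mu s) < eps). lra.
Qed.

(** The value [0] is not a square with [Re m > 0], so an explicit function is used: the limit of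
    [mode m / m^2] as [m] tends to [0]. Its derivative jumps by [-1] at [1], while [g'(0) = 0] and
    [g''(0) = 1], which matches [R = -1]. *)
Lemma zero_eigenvalue_at_minus_1 : is_eigenvalue (-1) (RtoC 0).
Proof.
  exists (pw (fun _ => RtoC (1 / 2)) (fun x => RtoC (x * x / 2)) (fun _ => RtoC (1 / 2))).
  split.
  - apply (solves_pw (-1) (RtoC 0) (RtoC 1) _ _ _
      (fun _ => RtoC 0) RtoC (fun _ => RtoC 0) (fun _ => RtoC 0) (fun _ => RtoC 1) (fun _ => RtoC 0) (1 / 2)).
    1-6: intros x; apply is_derive_pair; simpl; auto_derive; auto; field.
    1-3: f_equal; lra.
    + reflexivity.
    + intros x Hx. now rewrite Cmult_0_l.
    + intros x Hx. now rewrite Cmult_0_l, Cplus_0_r.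
    + intros x Hx. now rewrite Cmult_0_l.
    + intros x. unfold pw.
      destruct (Rlt_dec x (-1)); [ | destruct (Rlt_dec 1 x)]; rewrite Cmod_R, Rabs_pos_eq; nra.
    + unfold Cminus, Cplus, Cmult, Copp, RtoC; simpl. f_equal; ring.
    + unfold Cminus, Cplus, Cmult, Copp, RtoC; simpl. f_equal; ring.
  - exists 1. rewrite pw_mid by lra. intros H. apply RtoC_inj in H. lra.
Qed.

Lemma real_branch : exists Lam : R -> R,
  (forall r, continuous Lam r) /\ Lam (-1) = 0 /\
  (forall r, r <= -1 -> is_eigenvalue r (RtoC (Lam r))) /\
  (forall r, r < -1 -> 0 < Lam r).
Proof.
  destruct (functional_choice real_root real_root_exists) as [mu Hmu].
  (* The branch is the square of the real characteristic root at [s = - r]; it is identically [0]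
     for [r >= -1]. *)
  exists (fun r => mu (- r) * mu (- r)).
  assert (M1 : mu (- -1) = 0) by (destruct (Hmu (- -1)) as (_ & _ & _ & H); apply H; lra).
  refine (conj _ (conj _ (conj _ _))).
  - intros r.
    assert (C : continuous (fun r => mu (- r)) r).
    { apply (continuous_comp Ropp mu); [ | now apply continuous_real_root].
      apply (continuous_opp (V := R_NormedModule) (fun x => x)), continuous_id. }
    now apply (continuous_mult (K := R_AbsRing)).
  - rewrite M1. ring.
  - intros r [L | ->].
    + destruct (Hmu (- r)) as (_ & E & P & _). specialize (P ltac:(lra)).
      rewrite Rmax_right in E by lra.
      exists (mode (RtoC (mu (- r)))). rewrite RtoC_mult.
      apply mode_eigenfunction; [exact P | ].
      apply char_eq_iff. unfold char_eq, Re, Im; simpl.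
      rewrite cos_0, sin_0. lra.
    + rewrite M1, Rmult_0_l. exact zero_eigenvalue_at_minus_1.
  - intros r L. destruct (Hmu (- r)) as (_ & _ & P & _). specialize (P ltac:(lra)). nra.
Qed.

(** * The crossing branch *)

Lemma is_derive_pos_sign (f : R -> R) (x0 d : R) :
  is_derive f x0 d -> f x0 = 0 -> 0 < d ->
  locally x0 (fun x => (x < x0 -> f x < 0) /\ (x0 < x -> 0 < f x)).
Proof.
  intros D F0 Hd. apply is_derive_Reals in D.
  (* With tolerance [d] itself, the difference quotient stays within [d] of [d], hence positive. *)
  destruct (D d Hd) as [delta Hdelta].
  exists delta.
  enough (Sgn : forall x : R, Rabs (x - x0) < delta -> (x < x0 -> f x < 0) /\ (x0 < x -> 0 < f x))
    by exact Sgn.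
  intros x Hx.
  assert (K : x <> x0 -> 0 < f x / (x - x0)).
  { intros N. specialize (Hdelta (x - x0) ltac:(lra) Hx).
    replace (x0 + (x - x0)) with x in Hdelta by ring.
    rewrite F0, Rminus_0_r in Hdelta.
    apply Rabs_lt_between in Hdelta. lra. }
  split; intros L.
  - specialize (K ltac:(lra)).
    replace (f x) with (- (f x / (x - x0) * (x0 - x))) by (field; lra).
    assert (0 < f x / (x - x0) * (x0 - x)) by (apply Rmult_lt_0_compat; lra). lra.
  - specialize (K ltac:(lra)).
    replace (f x) with (f x / (x - x0) * (x - x0)) by (field; lra).
    apply Rmult_lt_0_compat; lra.
Qed.

(** The bracket [[37/10, 42/10]] lies in [(PI, 2 PI)], where [Kfun] is strictly increasing with
    positive derivative. *)
Lemma Kfun_local_inverse (a : R) : 37 / 10 < a < 42 / 10 ->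
  exists g : R -> R, g (Kfun a) = a /\ is_derive g (Kfun a) (/ Kder a) /\
    (forall k, Kfun (37 / 10) < k < Kfun (42 / 10) ->
       37 / 10 <= g k <= 42 / 10 /\ Kfun (g k) = k).
Proof.
  intros Ha. pose proof PI_bounds as HP.
  set (lb := 37 / 10) in *. set (ub := 42 / 10) in *.
  assert (Hlb : lb = 37 / 10) by reflexivity. assert (Hub : ub = 42 / 10) by reflexivity.
  assert (Sneg : forall y, lb <= y <= ub -> sin y < 0) by (intros; apply sin_lt_0; lra).
  assert (Der : forall y, lb <= y <= ub -> derivable_pt Kfun y).
  { intros y Hy. exists (Kder y). apply is_derive_Reals, is_derive_Kfun; [lra | auto]. }
  assert (Incr : forall x y, lb <= x -> x < y -> y <= ub -> Kfun x < Kfun y).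
  { intros. apply Kfun_increasing; lra. }
  (* The range condition sits under the existential so that choice yields a total [g]; outside the
     range the default is [0]. *)
  assert (Ex : forall k, exists y, Kfun lb <= k <= Kfun ub -> lb <= y <= ub /\ Kfun y = k).
  { intros k. destruct (classic (Kfun lb <= k <= Kfun ub)) as [H | H].
    - destruct (f_interv_is_interv Kfun lb ub k ltac:(lra) H) as (y & Hy).
      + intros x Hx. apply derivable_continuous_pt. auto.
      + exists y. auto.
    - exists 0. tauto. }
  destruct (functional_choice _ Ex) as [g Hg].
  assert (Hk : Kfun lb < Kfun a < Kfun ub) by (split; apply Incr; lra).
  assert (Inj : forall x y, lb <= x <= ub -> lb <= y <= ub -> Kfun x = Kfun y -> x = y).
  { intros x y Hx Hy E. destruct (Rtotal_order x y) as [L | [L | L]]; auto;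
    apply Incr in L; lra. }
  assert (Ga : g (Kfun a) = a).
  { destruct (Hg (Kfun a) ltac:(lra)). apply Inj; auto; lra. }
  exists g. refine (conj Ga (conj _ _)).
  - assert (DG : derivable_pt g (Kfun a)).
    { assert (Hl : lb < ub) by lra.
      assert (Hcomp : forall k, Kfun lb <= k -> k <= Kfun ub -> comp Kfun g k = id k).
      { intros k H1 H2. apply Hg. auto. }
      assert (Hwf : forall k, Kfun lb <= k -> k <= Kfun ub -> lb <= g k <= ub).
      { intros k H1 H2. apply Hg. auto. }
      apply (derivable_pt_recip_interv Kfun g lb ub (Kfun a) Hl Hk Hcomp Hwf Incr Der).
      - match goal with |- derive_pt _ _ ?pr <> 0 => 
          assert (E : derive_pt Kfun (g (Kfun a)) pr = Kder (g (Kfun a))) end.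
        { apply derive_pt_eq_0, is_derive_Reals. rewrite Ga. apply is_derive_Kfun;
          [lra | apply Sneg; lra]. }
        rewrite E, Ga. apply Rgt_not_eq, Kder_pos; [lra | apply Sneg; lra]. }
    destruct DG as [l Hl]. apply is_derive_Reals in Hl.
    replace (/ Kder a) with l; [exact Hl | ].
    assert (DK : is_derive Kfun (g (Kfun a)) (Kder a)) by (rewrite Ga; apply is_derive_Kfun;
      [lra | apply Sneg; lra]).
    (* Differentiating [Kfun (g k) = k] identifies the derivative of [g]. *)
    pose proof (is_derive_comp Kfun g _ _ _ DK Hl) as DC.
    assert (DI : is_derive (fun k => Kfun (g k)) (Kfun a) 1).
    { apply (is_derive_ext_loc (fun k => k)); [ | apply (is_derive_id (K := R_AbsRing))].
      apply (filter_imp (fun k => Kfun lb < k /\ k < Kfun ub)).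
      - intros k Hk'. symmetry. apply Hg. lra.
      - apply filter_and; [apply (open_gt (Kfun lb)) | apply (open_lt (Kfun ub))]; lra. }
    apply is_derive_unique in DC. apply is_derive_unique in DI. rewrite DI in DC.
    change (1 = l * Kder a) in DC.
    pose proof (Kder_pos a ltac:(lra) (Sneg a ltac:(lra))).
    apply (Rmult_eq_reg_r (Kder a)); [ | lra]. rewrite <- DC. field. lra.
  - intros k Hk'. apply Hg. lra.
Qed.

(** The root is [m = X + i Y]. The inequality [dy < dx] is transversality: at [R0] the derivative of
    [Re (m^2) = X^2 - Y^2] is [2 a0 (dx - dy)]. *)
Lemma crossing_branch (a0 : R) (Ha0 : 39 / 10 < a0 < 4) (Heq : cos a0 - sin a0 = exp (- a0)) :
  exists (X Y : R -> R) (dx dy : R),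
    X (R0_of a0) = a0 /\ Y (R0_of a0) = a0 /\
    is_derive X (R0_of a0) dx /\ is_derive Y (R0_of a0) dy /\ dy < dx /\
    locally (R0_of a0) (fun r => 0 < X r /\ char_eq r (X r) (Y r)).
Proof.
  destruct (a0_facts a0 Ha0 Heq) as (Hc & Hs & He).
  pose proof PI_bounds as HP.
  pose proof (R0_pos a0 Ha0 Heq) as HR. pose proof (Kfun_a0 a0 Ha0 Heq) as HK.
  destruct (char_eq_R0 a0 Ha0 Heq) as [E1 E2].
  destruct (Kfun_local_inverse a0 ltac:(lra)) as (g & Ga & Dg & Hg).
  rewrite HK in Ga, Dg. set (R0 := R0_of a0) in *.
  pose proof (Kder_pos a0 ltac:(lra) Hs) as HKd.
  set (Y := fun r => g (/ r - ln r)).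
  (* The imaginary part of the equation, [e^x = r (- y / sin y)], determines [x] once [y] is
     known. *)
  set (X := fun r => ln r + ln (- Y r / sin (Y r))).
  assert (YR0 : Y R0 = a0) by exact Ga.
  assert (Eexp : R0 * (- a0 / sin a0) = exp a0).
  { apply (Rmult_eq_reg_r (sin a0)); [ | lra]. rewrite E2. field. lra. }
  pose proof (Kfun_arg_pos a0 ltac:(lra) Hs) as Hp0.
  assert (XR0 : X R0 = a0).
  { unfold X. rewrite YR0, <- ln_mult, Eexp by assumption. apply ln_exp. }
  set (dy := - (/ (R0 * R0) + / R0) * / Kder a0).
  assert (DY : is_derive Y R0 dy).
  { apply (is_derive_comp g (fun r => / r - ln r) R0 _ _ Dg).
    auto_derive; [lra | field; lra]. }
  assert (Hdy : dy < 0).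
  { unfold dy. assert (0 < / Kder a0) by now apply Rinv_0_lt_compat.
    assert (0 < / R0) by now apply Rinv_0_lt_compat.
    assert (0 < / (R0 * R0)) by (apply Rinv_0_lt_compat; nra). nra. }
  set (dx := / R0 + dy * (/ a0 - cos a0 / sin a0)).
  assert (DX : is_derive X R0 dx).
  { apply (is_derive_plus (K := R_AbsRing) (V := R_NormedModule)).
    - auto_derive; [exact HR | field; lra].
    - apply (is_derive_comp (fun y => ln (- y / sin y)) Y R0); [rewrite YR0 | exact DY].
      auto_derive; [repeat split; auto; lra | field; lra]. }
  exists X, Y, dx, dy.
  refine (conj XR0 (conj YR0 (conj DX (conj DY (conj _ _))))).
  (* The factor [1 / a0 - cot a0] is the derivative of [ln (- y / sin y)] at [a0]. Being below [1]
     and multiplied by [dy < 0], it gives a product above [dy], to which [dx] adds [1 / R0 > 0]. *)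
  - assert (H1 : / a0 - cos a0 / sin a0 < 1).
    { assert (/ a0 < 1) by (rewrite <- Rinv_1; apply Rinv_lt_contravar; lra).
      assert (0 < cos a0 / sin a0).
      { replace (cos a0 / sin a0) with (- cos a0 / - sin a0) by (field; lra).
        apply Rdiv_lt_0_compat; lra. }
      lra. }
    assert (0 < / R0) by now apply Rinv_0_lt_compat.
    unfold dx. nra.
  - assert (CX : locally R0 (fun r => 0 < X r)).
    { assert (C : continuous X R0) by (apply (ex_derive_continuous X); now exists dx).
      apply (C (fun v => 0 < v)). apply (open_gt 0). lra. }
    assert (CL : locally R0 (fun r => Kfun (37 / 10) < / r - ln r /\ / r - ln r < Kfun (42 / 10))).
    { assert (C : continuous (fun r => / r - ln r) R0).
      { apply (ex_derive_continuous (fun r => / r - ln r)). auto_derive. lra. }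
      apply (C (fun v => Kfun (37 / 10) < v /\ v < Kfun (42 / 10))).
      rewrite <- HK. apply filter_and; [apply (open_gt (Kfun _)) | apply (open_lt (Kfun _))];
      apply Kfun_increasing; lra. }
    assert (CR : locally R0 (fun r => 0 < r)) by (apply (open_gt 0); exact HR).
    generalize (filter_and _ _ CX (filter_and _ _ CL CR)). apply filter_imp.
    intros r (PX & PL & PR). split; [exact PX | ].
    destruct (Hg (/ r - ln r) ltac:(lra)) as [HY KY].
    fold (Y r) in HY, KY.
    assert (Sy : sin (Y r) < 0) by (apply sin_lt_0; lra).
    pose proof (Kfun_arg_pos (Y r) ltac:(lra) Sy) as Hp.
    assert (Ex : exp (X r) = r * (- Y r / sin (Y r)))
      by (unfold X; rewrite exp_plus, !exp_ln by assumption; reflexivity).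
    assert (Lx : X r = ln r + ln (- Y r / sin (Y r))) by reflexivity.
    unfold Kfun in KY.
    split.
    + rewrite Ex.
      replace (r * (- Y r / sin (Y r)) * cos (Y r)) with
        (r * (- Y r * cos (Y r) / sin (Y r) + ln (- Y r / sin (Y r))) - r * ln (- Y r / sin (Y r))) by (field; lra).
      rewrite KY, Lx. field. lra.
    + rewrite Ex. field. lra.
Qed.

(** * Simplicity and transversal crossing *)

(** A Jordan chain would force [e^m + Rp = 0], that is [1 - Rp m + Rp = 0], whose imaginary part
    [- Rp Im m] is nonzero. *)
Lemma mode_eigenvalue_simple (Rp : R) (m : C) :
  0 < Re m -> Im m <> 0 -> Rp <> 0
    -> Cplus (Cminus (cexp m) (RtoC 1)) (Cmult (RtoC Rp) m) = RtoC 0 ->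
  simple_eigenvalue Rp (Cmult m m).
Proof.
  intros Hm HIm HRp Hc. pose proof (Re_pos_neq_0 m Hm) as Hm0.
  assert (Cb : forall b, Cmult b (Cminus (cexp m) (RtoC 1)) = RtoC 0 -> b = RtoC 0).
  { intros b Hb. apply NNPP. intros Nb. revert Hb. apply Cmult_neq_0; [exact Nb | ].
    intros K. apply (cexp_neq_1 m Hm).
    transitivity (Cplus (Cminus (cexp m) (RtoC 1)) (RtoC 1)); [ring | rewrite K; ring]. }
  exists (mode m). refine (conj _ (conj _ _)).
  - now apply mode_eigenfunction.
  - intros h [Hh _].
    destruct (solves_forced_by_mode Rp m (RtoC 0) h Hm) as (b & c & Hb & _ & Hform).
    { replace (fun x : R => Cmult (RtoC 0) (mode m x)) with (fun _ : R => RtoC 0); [exact Hh | ].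
      apply functional_extensionality. intros t. ring. }
    exists (Cdiv c (Cmult m m)). apply Hform; auto.
  - intros [h Hh].
    destruct (solves_forced_by_mode Rp m (RtoC 1) h Hm) as (b & c & _ & K & _).
    { replace (fun x : R => Cmult (RtoC 1) (mode m x)) with (mode m); [exact Hh | ].
      apply functional_extensionality. intros t. ring. }
    assert (E : cexp m = Cminus (RtoC 1) (Cmult (RtoC Rp) m)).
    { transitivity (Cplus (Cplus (Cminus (cexp m) (RtoC 1)) (Cmult (RtoC Rp) m)) (Cminus (RtoC 1) (Cmult (RtoC Rp) m))); [ring | ].
      rewrite Hc. ring. }
    rewrite E in K.
    assert (K' : Cplus (Cminus (RtoC 1) (Cmult (RtoC Rp) m)) (RtoC Rp) = RtoC 0).
    { transitivity (Cdiv (Cmult m (Cplus (Cminus (RtoC 1) (Cmult (RtoC Rp) m)) (RtoC Rp))) m);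
      [field; auto | ].
      replace (Cmult m (Cplus (Cminus (RtoC 1) (Cmult (RtoC Rp) m)) (RtoC Rp))) with (RtoC 0);
        [field; auto | ].
      rewrite <- K. ring. }
    apply (f_equal Im) in K'. unfold Im in *; simpl in *.
    apply HRp. apply (Rmult_eq_reg_r (snd m)); [ | exact HIm]. lra.
Qed.

Theorem theorem1 (a0 : R) (Ha0 : 39/10 < a0 < 4)
  (Heq : cos a0 - sin a0 = exp (- a0)) :
  let R0 := (1 - exp a0 * cos a0) / a0 in
  (* spectral stability for -1 <= R <= R0 *)
  (forall (Rp : R) (lam : C), -1 <= Rp <= R0 -> is_eigenvalue Rp lam -> Re lam <= 0) /\
  (* at R = -1 a real eigenvalue branch passes through 0 and is positive for R < -1 *)
  (exists Lam : R -> R,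
     (forall r, continuous Lam r) /\
     Lam (-1) = 0 /\
     (forall r, r <= -1 -> is_eigenvalue r (RtoC (Lam r))) /\
     (forall r, r < -1 -> 0 < Lam r)) /\
  (* at R = R0 a pair of simple nonzero complex conjugate eigenvalues crosses
     the imaginary axis from left to right *)
  (exists omega : R, omega <> 0 /\
     simple_eigenvalue R0 (0, omega) /\ simple_eigenvalue R0 (0, - omega) /\
     exists eps : R, 0 < eps /\
     exists Lam : R -> C,
       Lam R0 = (0, omega) /\
       (forall r, Rabs (r - R0) < eps ->
          is_eigenvalue r (Lam r) /\ is_eigenvalue r (Cconj (Lam r))) /\
       (exists d : C, is_derive Lam R0 d /\ 0 < Re d) /\
       (forall r, R0 - eps < r < R0 -> Re (Lam r) < 0) /\
       (forall r, R0 < r < R0 + eps -> 0 < Re (Lam r))).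
Proof.
  intros R0. change R0 with (R0_of a0). clear R0.
  refine (conj (stable_below_R0 a0 Ha0 Heq) (conj real_branch _)).
  pose proof (R0_pos a0 Ha0 Heq) as HR0.
  destruct (crossing_branch a0 Ha0 Heq) as (X & Y & dx & dy & X0 & Y0 & DX & DY & Hd & Loc).
  set (R0 := R0_of a0) in *.
  assert (Conj : forall r x y, char_eq r x y -> char_eq r x (- y)).
  { intros r x y [E1 E2]. split; [rewrite cos_neg | rewrite sin_neg]; lra. }
  assert (CE := char_eq_R0 a0 Ha0 Heq). fold R0 in CE.
  assert (Simple : forall y, Rabs y = a0 -> char_eq R0 a0 y
    -> simple_eigenvalue R0 (0, 2 * a0 * y)).
  { intros y Hy H.
    replace ((0, 2 * a0 * y) : C) with (Cmult (a0, y) (a0, y)).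
    - apply mode_eigenvalue_simple; unfold Re, Im; simpl; try lra.
      + intros ->. rewrite Rabs_R0 in Hy. lra.
      + now apply char_eq_iff.
    - assert (y * y = a0 * a0) by (rewrite <- Hy; apply Rsqr_abs).
      unfold Cmult; simpl. f_equal; lra. }
  (* This is the imaginary part of [(a0 (1 + i))^2]. *)
  exists (2 * a0 * a0). refine (conj _ (conj _ (conj _ _))).
  - nra.
  - apply Simple; auto. apply Rabs_pos_eq. lra.
  - replace (- (2 * a0 * a0)) with (2 * a0 * (- a0)) by ring.
    apply Simple; auto. rewrite Rabs_Ropp. apply Rabs_pos_eq. lra.
  - set (Lam := fun r => Cmult (X r, Y r) (X r, Y r)).
    set (d := Cplus (Cmult (dx, dy) (X R0, Y R0)) (Cmult (X R0, Y R0) (dx, dy))).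
    assert (DL : is_derive Lam R0 d).
    { apply (is_derive_C_mult (fun r => (X r, Y r) : C) (fun r => (X r, Y r) : C));
      apply is_derive_pair; assumption. }
    assert (Hd' : 0 < Re d) by (unfold d, Re; simpl; rewrite X0, Y0; nra).
    assert (L0 : Lam R0 = (0, 2 * a0 * a0)).
    { unfold Lam. rewrite X0, Y0. unfold Cmult; simpl. f_equal; ring. }
    assert (Sg := is_derive_pos_sign (fun r => Re (Lam r)) R0 (Re d)
      (is_derive_fst _ _ _ DL) (f_equal Re L0) Hd').
    destruct (filter_and _ _ Loc Sg) as [eps Heps].
    assert (Heps' : forall r, Rabs (r - R0) < eps -> (0 < X r /\ char_eq r (X r) (Y r)) /\
       (r < R0 -> Re (Lam r) < 0) /\ (R0 < r -> 0 < Re (Lam r))) by exact Heps.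
    exists eps. split; [apply cond_pos | ].
    exists Lam. refine (conj L0 (conj _ (conj (ex_intro _ d (conj DL Hd')) (conj _ _)))).
    + intros r Hr. destruct (Heps' r Hr) as [[PX E] _].
      split.
      * exists (mode (X r, Y r)). apply mode_eigenfunction; [exact PX | now apply char_eq_iff].
      (* The conjugate eigenvalue is the square of the conjugate root, which solves the same
         equation because its coefficients are real. *)
      * unfold Lam. rewrite Cmult_conj. exists (mode (Cconj (X r, Y r))).
        apply mode_eigenfunction; [exact PX | ]. apply char_eq_iff. now apply Conj.
    + intros r Hr. apply (Heps' r); [ | lra]. apply Rabs_lt_between. lra.
    + intros r Hr. apply (Heps' r); [ | lra]. apply Rabs_lt_between. lra.
Qed.
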